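(* Let $A$ be an artin algebra and $$A=H_{0}>H_{1}> \cdots > H_i > \cdots >H_{n}=0 \qquad ( * )$$ a chain of idempotent ideals of $A$. For $0 \leq i \leq n-1$, write $H_i = Ae_iA$, where $e_i$ is an idempotent of $A$, and let $e_n=0$. Then the following conditions are equivalent: (i) $( * )$ is a right-strongly (resp. left-strongly) heredity chain. (ii) The chain $$\mathrm{proj}\, A=\mathrm{add}\, e_0 A \supset \mathrm{add}\, e_1 A \supset \cdots \supset \mathrm{add}\, e_n A =0$$ is a total right (resp. left) rejective chain of $\mathrm{proj}\, A$. (iii) $( * )$ is a heredity chain of $A$ and the chain $$\mathrm{proj}\, A=\mathrm{add}\, e_0 A \supset \mathrm{add}\, e_1 A \supset \cdots \supset \mathrm{add}\, e_n A =0$$ is a coreflective (resp. reflective) chain of $\mathrm{proj}\, A$.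
   Context: $J(A)$ is the Jacobson radical of $A$; $\mathrm{proj}\,A$ is the category of finitely generated projective right $A$-modules; $\mathrm{add}\,M$ is the full subcategory of direct summands of finite direct sums of copies of $M$. All subcategories are assumed full and closed under isomorphisms, direct sums and direct summands. Heredity chains: a two-sided ideal $H$ of $A$ is called heredity if (a) $H^2=H$ (equivalently $H=AeA$ for some idempotent $e$); (b) $H$ is projective as a right $A$-module; (c) $HJ(A)H=0$. A chain of idempotent ideals $A=H_0>H_1>\cdots>H_n=0$ is a heredity chain if $H_i/H_{i+1}$ is a heredity ideal of $A/H_{i+1}$ for $0\le i\le n-1$. It is a right-strongly (resp. left-strongly) heredity chain if for every $0\le i\le n-1$: (a) $H_i$ is projective as a right (resp. left) $A$-module; (b) $(H_i/H_{i+1})\,J(A/H_{i+1})\,(H_i/H_{i+1})=0$. Subcategories: let $\mathcal C$ be an additive category and $\mathcal C'$ a subcategory. $\mathcal C'$ is coreflective (resp. reflective) in $\mathcal C$ if the inclusion functor $\mathcal C'\hookrightarrow\mathcal C$ has a right (resp. left) adjoint. $\mathcal C'$ is right (resp. left) rejective in $\mathcal C$ if the inclusion functor has a right (resp. left) adjoint whose counit $\varepsilon^-_X$ is a monomorphism in $\mathcal C$ (resp. whose unit $\varepsilon^+_X$ is an epimorphism in $\mathcal C$) for every $X\in\mathcal C$. Let $[\mathcal C']$ be the ideal of $\mathcal C$ of morphisms factoring through an object of $\mathcal C'$; for $\mathcal C$ Krull–Schmidt, $\mathcal C'$ is cosemisimple in $\mathcal C$ if the Jacobson radical of the factor category $\mathcal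 C/[\mathcal C']$ is zero. Chains: a chain of subcategories $\mathcal C=\mathcal C_0\supset\mathcal C_1\supset\cdots\supset\mathcal C_n=0$ is a total right (resp. left) rejective chain of $\mathcal C$ if for $1\le i\le n$, (a) $\mathcal C_i$ is a right (resp. left) rejective subcategory of $\mathcal C$ and (b) $\mathcal C_i$ is a cosemisimple subcategory of $\mathcal C_{i-1}$. It is a coreflective (resp. reflective) chain if $\mathcal C_i$ is a cosemisimple coreflective (resp. reflective) subcategory of $\mathcal C_{i-1}$ for $1\le i\le n$. *)

(* Defs.v *)
From HB Require Import structures.
From mathcomp Require Import all_boot all_algebra.
From mathcomp Require Import boolp classical_sets.

Set Implicit Arguments.
Unset Strict Implicit.
Unset Printing Implicit Defensive.

Import GRing.Theory.
Local Open Scope quotient_scope.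
Local Open Scope classical_set_scope.
Local Open Scope ring_scope.

Record precat := PreCat {
  ob :> Type;
  mor : ob -> ob -> zmodType;
  idm : forall X, mor X X;
  mcomp : forall X Y Z, mor Y Z -> mor X Y -> mor X Z;
  comp1m : forall X Y (f : mor X Y), mcomp (idm Y) f = f;
  compm1 : forall X Y (f : mor X Y), mcomp f (idm X) = f;
  compA : forall X Y Z W (h : mor Z W) (g : mor Y Z) (f : mor X Y),
    mcomp h (mcomp g f) = mcomp (mcomp h g) f;
  compDl : forall X Y Z (g g' : mor Y Z) (f : mor X Y),
    mcomp (g + g') f = mcomp g f + mcomp g' f;
  compDr : forall X Y Z (g : mor Y Z) (f f' : mor X Y),
    mcomp g (f + f') = mcomp g f + mcomp g f' }.

Arguments idm {p} X.
Arguments mcomp {p X Y Z} g f.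

Notation "g \oc f" := (mcomp g f) (at level 40, left associativity).

Section PreCatTheory.
Variable C : precat.
Implicit Types X Y Z : C.

Definition monom X Y (m : mor X Y) : Prop :=
  forall W (f g : mor W X), m \oc f = m \oc g -> f = g.

Definition epim X Y (e : mor X Y) : Prop :=
  forall W (f g : mor Y W), f \oc e = g \oc e -> f = g.

Definition isom X Y (f : mor X Y) : Prop :=
  exists g : mor Y X, g \oc f = idm X /\ f \oc g = idm Y.

Definition zero_obj Z : Prop :=
  forall X, (forall f : mor X Z, f = 0) /\ (forall f : mor Z X, f = 0).

Definition direct_sum X Y Z : Prop :=
  exists (i1 : mor X Z) (i2 : mor Y Z) (p1 : mor Z X) (p2 : mor Z Y),
    [/\ p1 \oc i1 = idm X, p2 \oc i2 = idm Y, p2 \oc i1 = 0, p1 \oc i2 = 0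
      & i1 \oc p1 + i2 \oc p2 = idm Z].

Definition direct_power X m Z : Prop :=
  exists (i_ : 'I_m -> mor X Z) (p_ : 'I_m -> mor Z X),
    [/\ forall k, p_ k \oc i_ k = idm X,
        forall k l, k != l -> p_ l \oc i_ k = 0
      & \sum_(k < m) i_ k \oc p_ k = idm Z].

Definition direct_summand X Z : Prop := exists Y, direct_sum X Y Z.

(* Kelly's description of the radical of a preadditive category. *)
Definition cat_jacobson X Y (f : mor X Y) : Prop :=
  forall g : mor Y X, isom (idm X - g \oc f).

Lemma comp0m X Y Z (f : mor X Y) : (0 : mor Y Z) \oc f = 0.
Proof. by apply: (addIr (0 \oc f)); rewrite -compDl !add0r. Qed.

Lemma compm0 X Y Z (g : mor Y Z) : g \oc (0 : mor X Y) = 0.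
Proof. by apply: (addIr (g \oc 0)); rewrite -compDr !add0r. Qed.

Lemma compNm X Y Z (g : mor Y Z) (f : mor X Y) : (- g) \oc f = - (g \oc f).
Proof. by apply: (addrI (g \oc f)); rewrite -compDl !subrr comp0m. Qed.

Lemma compmN X Y Z (g : mor Y Z) (f : mor X Y) : g \oc (- f) = - (g \oc f).
Proof. by apply: (addrI (g \oc f)); rewrite -compDr !subrr compm0. Qed.

Lemma compBl X Y Z (g g' : mor Y Z) (f : mor X Y) :
  (g - g') \oc f = g \oc f - g' \oc f.
Proof. by rewrite compDl compNm. Qed.

Lemma compBr X Y Z (g : mor Y Z) (f f' : mor X Y) :
  g \oc (f - f') = g \oc f - g \oc f'.
Proof. by rewrite compDr compmN. Qed.

Lemma zero_obj_id Z : idm Z = 0 -> zero_obj Z.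
Proof.
move=> Z0 X; split=> f; first by rewrite -[f]comp1m Z0 comp0m.
by rewrite -[f]compm1 Z0 compm0.
Qed.

End PreCatTheory.

Record addcat := AddCat {
  addcat_pre :> precat;
  has_zero_obj : exists Z : addcat_pre, zero_obj Z;
  has_direct_sum : forall X Y : addcat_pre, exists Z, direct_sum X Y Z }.

Record functor (C D : precat) := Functor {
  fobj :> C -> D;
  fmap : forall X Y, mor X Y -> mor (fobj X) (fobj Y);
  fmap1 : forall X, fmap (idm X) = idm (fobj X);
  fmapM : forall X Y Z (g : mor Y Z) (f : mor X Y),
    fmap (g \oc f) = fmap g \oc fmap f }.

Arguments fmap {C D} _ {X Y} _.

Record adjunction (C D : precat) (L : functor C D) (G : functor D C) :=
  Adjunction {
    adj_unit : forall X : C, mor X (G (L X));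
    adj_counit : forall Y : D, mor (L (G Y)) Y;
    unit_nat : forall X X' (f : mor X X'),
      fmap G (fmap L f) \oc adj_unit X = adj_unit X' \oc f;
    counit_nat : forall Y Y' (f : mor Y Y'),
      f \oc adj_counit Y = adj_counit Y' \oc fmap L (fmap G f);
    adj_triangleL : forall X,
      adj_counit (L X) \oc fmap L (adj_unit X) = idm (L X);
    adj_triangleR : forall Y,
      fmap G (adj_counit Y) \oc adj_unit (G Y) = idm (G Y) }.

Definition full_pre (C : precat) (P : C -> Prop) : precat :=
  @PreCat {X : C | P X} (fun X Y => mor (sval X) (sval Y))
    (fun X => idm (sval X)) (fun X Y Z g f => g \oc f)
    (fun X Y => @comp1m C (sval X) (sval Y))
    (fun X Y => @compm1 C (sval X) (sval Y))
    (fun X Y Z W => @compA C (sval X) (sval Y) (sval Z) (sval W))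
    (fun X Y Z => @compDl C (sval X) (sval Y) (sval Z))
    (fun X Y Z => @compDr C (sval X) (sval Y) (sval Z)).

Record subcat (C : addcat) := SubCat {
  in_subcat :> C -> Prop;
  subcat_zero : forall Z, zero_obj Z -> in_subcat Z;
  subcat_iso : forall X Y (f : mor X Y), isom f -> in_subcat X -> in_subcat Y;
  subcat_sum : forall X Y Z,
    direct_sum X Y Z -> in_subcat X -> in_subcat Y -> in_subcat Z;
  subcat_summand : forall X Z,
    direct_summand X Z -> in_subcat Z -> in_subcat X }.

Section Subcategories.
Variable C : addcat.

Lemma full_has_zero_obj (S : subcat C) :
  exists Z : full_pre S, zero_obj Z.
Proof.
have [Z Z0] := has_zero_obj C.
by exists (exist _ Z (subcat_zero S Z0)) => X; apply: Z0.
Qed.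

Lemma full_has_direct_sum (S : subcat C) (X Y : full_pre S) :
  exists Z, direct_sum X Y Z.
Proof.
have [Z XYZ] := has_direct_sum (sval X) (sval Y).
exists (exist _ Z (subcat_sum XYZ (svalP X) (svalP Y))).
exact: XYZ.
Qed.

Definition full (S : subcat C) : addcat :=
  AddCat (full_has_zero_obj S) (@full_has_direct_sum S).

Definition inclusion (S : subcat C) : functor (full S) C :=
  @Functor (full S) C (fun X => sval X) (fun X Y f => f)
    (fun X => erefl) (fun X Y Z g f => erefl).

(* T need not be contained in S: the objects are those of S that lie in T. *)
Definition sub_in (S T : subcat C) : subcat (full S).
Proof.
apply: (@SubCat (full S) (fun X => T (sval X))).
- move=> Z Z0; apply/subcat_zero/zero_obj_id.
  exact: (proj1 (Z0 Z)).
- by move=> X Y f; apply: (@subcat_iso C T _ _ f).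
- by move=> X Y Z; apply: (@subcat_sum C T).
- by move=> X Z [Y XYZ]; apply: (@subcat_summand C T); exists (sval Y).
Defined.

Definition coreflective (S : subcat C) : Prop :=
  exists G : functor C (full S), inhabited (adjunction (inclusion S) G).

Definition reflective (S : subcat C) : Prop :=
  exists G : functor C (full S), inhabited (adjunction G (inclusion S)).

Definition right_rejective (S : subcat C) : Prop :=
  exists (G : functor C (full S)) (a : adjunction (inclusion S) G),
    forall X : C, monom (adj_counit a X).

Definition left_rejective (S : subcat C) : Prop :=
  exists (G : functor C (full S)) (a : adjunction G (inclusion S)),
    forall X : C, epim (adj_unit a X).

End Subcategories.

Record catideal (C : precat) := CatIdeal {
  in_catideal : forall X Y : C, mor X Y -> Prop;
  catideal0 : forall X Y, in_catideal (0 : mor X Y);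
  catidealB : forall X Y (f g : mor X Y),
    in_catideal f -> in_catideal g -> in_catideal (f - g);
  catidealMl : forall X Y Z (g : mor Y Z) (f : mor X Y),
    in_catideal f -> in_catideal (g \oc f);
  catidealMr : forall X Y Z (g : mor Y Z) (f : mor X Y),
    in_catideal g -> in_catideal (g \oc f) }.

Arguments in_catideal {C} _ {X Y} f.

Section FactorCategory.
Variables (C : precat) (I : catideal C).

Definition catideal_pred (X Y : C) : {pred mor X Y} :=
  fun f => `[< in_catideal I f >].

Lemma catideal_zmod X Y : zmod_closed (@catideal_pred X Y).
Proof.
split=> [|f g /asboolP If /asboolP Ig]; first exact/asboolP/catideal0.
exact/asboolP/catidealB.
Qed.

HB.instance Definition _ X Y :=
  GRing.isZmodClosed.Build (mor X Y) (@catideal_pred X Y) (@catideal_zmod X Y).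

Definition factor_hom (X Y : C) : zmodType :=
  Quotient.quot (@catideal_pred X Y).

Definition factor_pi (X Y : C) (f : mor X Y) : factor_hom X Y := \pi f.

Lemma factor_piP X Y (f g : mor X Y) :
  factor_pi f = factor_pi g <-> in_catideal I (f - g).
Proof.
have e := Quotient.idealrBE (@catideal_pred X Y) f g.
split=> [fg|Ifg].
  suff: f - g \in @catideal_pred X Y by move/asboolP.
  by rewrite e; apply/eqP.
by apply/eqP; rewrite -e; apply/asboolP.
Qed.

Definition factor_repr (X Y : C) (f : factor_hom X Y) : mor X Y := repr f.

Lemma factor_reprK X Y (f : factor_hom X Y) : factor_pi (factor_repr f) = f.
Proof. exact: reprK. Qed.

Lemma factor_piD X Y (f g : mor X Y) :
  factor_pi (f + g) = factor_pi f + factor_pi g.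
Proof. exact: raddfD. Qed.

Definition factor_comp X Y Z (g : factor_hom Y Z) (f : factor_hom X Y) :
  factor_hom X Z := factor_pi (factor_repr g \oc factor_repr f).

Lemma factor_compE X Y Z (g : mor Y Z) (f : mor X Y) :
  factor_comp (factor_pi g) (factor_pi f) = factor_pi (g \oc f).
Proof.
apply/factor_piP; set g' := factor_repr _; set f' := factor_repr _.
have -> : g' \oc f' - g \oc f = (g' - g) \oc f' - g \oc (f - f').
  by rewrite compBl compBr opprB addrA subrK.
apply: catidealB; [apply: catidealMr | apply: catidealMl];
  by apply/factor_piP; rewrite factor_reprK.
Qed.

Definition factor_cat : precat.
Proof.
apply: (@PreCat C factor_hom (fun X => factor_pi (idm X)) factor_comp).
- by move=> X Y f; rewrite -[f]factor_reprK factor_compE comp1m.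
- by move=> X Y f; rewrite -[f]factor_reprK factor_compE compm1.
- move=> X Y Z W h g f; rewrite -[f]factor_reprK -[g]factor_reprK.
  by rewrite -[h]factor_reprK !factor_compE compA.
- move=> X Y Z g g' f; rewrite -[f]factor_reprK -[g]factor_reprK.
  by rewrite -[g']factor_reprK -factor_piD !factor_compE compDl factor_piD.
- move=> X Y Z g f f'; rewrite -[f]factor_reprK -[g]factor_reprK.
  by rewrite -[f']factor_reprK -factor_piD !factor_compE compDr factor_piD.
Defined.

End FactorCategory.

Section Summands.
Variable C : addcat.
Implicit Types X Y Z : C.

Lemma absorb1 X Y (p : mor X Y) (i : mor Y X) : p \oc i = idm Y ->
  forall Z (f : mor Z Y), p \oc (i \oc f) = f.
Proof. by move=> pi Z f; rewrite compA pi comp1m. Qed.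

Lemma absorb0 X Y Z (p : mor X Y) (i : mor Z X) : p \oc i = 0 ->
  forall W (f : mor W Z), p \oc (i \oc f) = 0.
Proof. by move=> pi W f; rewrite compA pi comp0m. Qed.

Lemma isom_summand X Y (f : mor X Y) : isom f -> direct_summand Y X.
Proof.
case=> g [gf fg]; have [Z Z0] := has_zero_obj C; exists Z, g, 0, f, 0.
split=> //; rewrite ?comp0m ?compm0 ?addr0 //.
by apply/esym; apply: (proj1 (Z0 Z)).
Qed.

Lemma direct_summand_trans X Y Z :
  direct_summand X Y -> direct_summand Y Z -> direct_summand X Z.
Proof.
case=> X' [i1 [i2 [p1 [p2 [e11 e22 e21 e12 e]]]]].
case=> Y' [j1 [j2 [q1 [q2 [d11 d22 d21 d12 d]]]]].
have [W [k1 [k2 [r1 [r2 [c11 c22 c21 c12 c]]]]]] := has_direct_sum X' Y'.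
exists W, (j1 \oc i1), (j1 \oc i2 \oc r1 + j2 \oc r2), (p1 \oc q1),
  (k1 \oc p2 \oc q1 + k2 \oc q2).
have E := (absorb1 e11, absorb1 e22, absorb0 e21, absorb0 e12).
have D := (absorb1 d11, absorb1 d22, absorb0 d21, absorb0 d12).
have K := (absorb1 c11, absorb1 c22, absorb0 c21, absorb0 c12).
split; rewrite ?compDl ?compDr -?compA ?(D, E, K, compm0, addr0, add0r) //.
- by rewrite e21 compm0.
by rewrite addrA -compDr (compA i1) (compA i2) -compDl e comp1m.
Qed.

Lemma direct_sum_summand X X' Y Y' Z :
  direct_summand X X' -> direct_summand Y Y' -> direct_sum X Y Z ->
  exists2 Z', direct_sum X' Y' Z' & direct_summand Z Z'.
Proof.
case=> U [i1 [i2 [p1 [p2 [e11 e22 e21 e12 e]]]]].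
case=> V [j1 [j2 [q1 [q2 [d11 d22 d21 d12 d]]]]].
case=> k1 [k2 [r1 [r2 [c11 c22 c21 c12 c]]]].
have [W [l1 [l2 [t1 [t2 [b11 b22 b21 b12 b]]]]]] := has_direct_sum U V.
have [Z' ds] := has_direct_sum X' Y'; exists Z' => //.
have [a1 [a2 [s1 [s2 [f11 f22 f21 f12 f]]]]] := ds.
exists W, (a1 \oc i1 \oc r1 + a2 \oc j1 \oc r2),
  (a1 \oc i2 \oc t1 + a2 \oc j2 \oc t2),
  (k1 \oc p1 \oc s1 + k2 \oc q1 \oc s2),
  (l1 \oc p2 \oc s1 + l2 \oc q2 \oc s2).
have F := (absorb1 f11, absorb1 f22,
           absorb0 f21, absorb0 f12).
have E := (absorb1 e11, absorb1 e22,
           absorb0 e21, absorb0 e12).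
have D := (absorb1 d11, absorb1 d22,
           absorb0 d21, absorb0 d12).
have K := (absorb1 c11, absorb1 c22,
           absorb0 c21, absorb0 c12).
have B := (absorb1 b11, absorb1 b22,
           absorb0 b21, absorb0 b12).
split; rewrite !compDl !compDr -!compA !(F, E, D, K, B, compm0, addr0, add0r) //.
rewrite addrACA -!compDr (compA i1) (compA i2) (compA j1) (compA j2).
by rewrite -!compDl e d !comp1m.
Qed.

Lemma direct_power_sum M m m' X Y Z :
  direct_power M m X -> direct_power M m' Y -> direct_sum X Y Z ->
  direct_power M (m + m') Z.
Proof.
case=> i_ [p_ [e1 e0 e]] [j_ [q_ [d1 d0 d]]].
case=> k1 [k2 [r1 [r2 [c11 c22 c21 c12 c]]]].
exists (fun k => match split k with
  inl a => k1 \oc i_ a | inr b => k2 \oc j_ b end).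
exists (fun k => match split k with
  inl a => p_ a \oc r1 | inr b => q_ b \oc r2 end).
have A1 U (g : mor X U) : g \oc r1 \oc k1 = g.
  by rewrite -compA c11 compm1.
have A2 U (g : mor Y U) : g \oc r2 \oc k2 = g.
  by rewrite -compA c22 compm1.
split=> [k|k l|].
- by case: (split k) => a; rewrite compA ?A1 ?A2.
- rewrite -(inj_eq (can_inj (@splitK m m'))).
  case: (split k) (split l) => [a|a] [b|b] ab; rewrite compA.
  + by rewrite A1 e0.
  + by rewrite -(compA (q_ b)) c21 compm0 comp0m.
  + by rewrite -(compA (p_ b)) c12 compm0 comp0m.
  + by rewrite A2 d0.
rewrite big_split_ord /=.
under eq_bigr => k _ do rewrite (unsplitK (inl k)) compA -(compA k1).
under [X in _ + X]eq_bigr => k _ do rewrite (unsplitK (inr k)) compA -(compA k2).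
have sumE U V W (F : 'I_W -> mor U U) (h : mor U V) (g : mor V U) :
    \sum_(k < W) (h \oc F k \oc g) = h \oc (\sum_(k < W) F k) \oc g.
  elim: W F => [|w IH] F; first by rewrite !big_ord0 compm0 comp0m.
  by rewrite !big_ord_recr /= IH compDr compDl.
by rewrite !sumE e d !compm1.
Qed.

Lemma subcat_power (S : subcat C) M m Z : S M -> direct_power M m Z -> S Z.
Proof.
move=> SM; elim: m Z => [|m IH] Z [i_ [p_ [e1 e0 e]]].
  by apply/subcat_zero/zero_obj_id; rewrite -e big_ord0.
have [W [SW MW]] : exists W, S W /\ direct_power M m W.
  elim: m {IH i_ p_ e1 e0 e} => [|m [W [SW MW]]].
    have [W W0] := has_zero_obj C; exists W; split; first exact: subcat_zero.
    exists (fun _ => 0), (fun _ => 0); split=> [[]|[]|] //.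
    by rewrite big_ord0; apply/esym; apply: (proj1 (W0 W)).
  have [V MWV] := has_direct_sum M W; exists V.
  split; first exact: subcat_sum MWV SM SW.
  apply: (@direct_power_sum M 1 m M W V) => //.
  exists (fun _ => idm M), (fun _ => idm M); split=> [k|k l|].
  - by rewrite comp1m.
  - by rewrite !ord1.
  - by rewrite big_ord1 comp1m.
have [V MWV] := has_direct_sum M W.
have SV : S V by exact: subcat_sum MWV SM SW.
have sumr X Y T n (h : mor Y T) (F : 'I_n -> mor X Y) :
    h \oc (\sum_k F k) = \sum_k (h \oc F k).
  by elim: n F => [|n IHn] F; rewrite ?big_ord0 ?compm0 // !big_ord_recr /=
    compDr IHn.
have suml X Y T n (h : mor X Y) (F : 'I_n -> mor Y T) :
    (\sum_k F k) \oc h = \sum_k (F k \oc h).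
  by elim: n F => [|n IHn] F; rewrite ?big_ord0 ?comp0m // !big_ord_recr /=
    compDl IHn.
have powV : direct_power M m.+1 V.
  apply: (@direct_power_sum M 1 m M W V) => //.
  exists (fun _ => idm M), (fun _ => idm M); split=> [k|k l|].
  - by rewrite comp1m.
  - by rewrite !ord1.
  - by rewrite big_ord1 comp1m.
have [j_ [q_ [d1 d0 d]]] := powV.
have invE X Y (a_ : 'I_m.+1 -> mor M X) (b_ : 'I_m.+1 -> mor X M)
    (a'_ : 'I_m.+1 -> mor M Y) (b'_ : 'I_m.+1 -> mor Y M) :
    (forall k, b_ k \oc a_ k = idm M) ->
    (forall k l, k != l -> b_ l \oc a_ k = 0) ->
    \sum_k a'_ k \oc b'_ k = idm Y ->
    (\sum_k a'_ k \oc b_ k) \oc (\sum_k a_ k \oc b'_ k) = idm Y.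
  move=> h1 h0 <-; rewrite suml; apply: eq_bigr => k _.
  rewrite sumr (bigD1 k) //= big1 => [|l lk].
    by rewrite -compA (absorb1 (h1 k)) addr0.
  by rewrite -compA (absorb0 (h0 _ _ lk)) compm0.
apply: (@subcat_iso C S V Z (\sum_k i_ k \oc q_ k)) => //.
by exists (\sum_k j_ k \oc p_ k); split; apply: invE.
Qed.

Section Add.
Variable M : C.

Definition in_add X : Prop :=
  exists m Z, direct_power M m Z /\ direct_summand X Z.

Lemma in_add_zero Z : zero_obj Z -> in_add Z.
Proof.
move=> Z0; exists 0%N, Z; split.
  exists (fun _ => 0), (fun _ => 0); split=> [[]|[]|] //.
  by rewrite big_ord0; apply/esym; apply: (proj1 (Z0 Z)).
apply: (@isom_summand Z Z (idm Z)).
by exists (idm Z); rewrite comp1m.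
Qed.

Lemma in_add_summand X Z : direct_summand X Z -> in_add Z -> in_add X.
Proof.
move=> XZ [m [W [MW ZW]]]; exists m, W; split=> //.
exact: direct_summand_trans ZW.
Qed.

Lemma in_add_iso X Y (f : mor X Y) : isom f -> in_add X -> in_add Y.
Proof. by move=> isof; apply: in_add_summand; apply: isom_summand isof. Qed.

Lemma in_add_sum X Y Z : direct_sum X Y Z -> in_add X -> in_add Y -> in_add Z.
Proof.
move=> XYZ [m [X' [MX' XX']]] [m' [Y' [MY' YY']]].
have [Z' X'Y'Z' ZZ'] := direct_sum_summand XX' YY' XYZ.
by exists (m + m')%N, Z'; split=> //; apply: direct_power_sum X'Y'Z'.
Qed.

Definition add : subcat C :=
  SubCat in_add_zero in_add_iso in_add_sum in_add_summand.

End Add.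

End Summands.

Section Cosemisimple.
Variables (C : addcat) (S : subcat C).

Definition factors_through (X Y : C) (f : mor X Y) : Prop :=
  exists Z : C, S Z /\ exists (g : mor Z Y) (h : mor X Z), f = g \oc h.

Definition subcat_ideal : catideal C.
Proof.
apply: (@CatIdeal C factors_through).
- move=> X Y; have [Z Z0] := has_zero_obj C; exists Z.
  split; first exact: subcat_zero.
  by exists 0, 0; rewrite comp0m.
- move=> X Y _ _ [Z [SZ [g [h ->]]]] [Z' [SZ' [g' [h' ->]]]].
  have [W ZZ'W] := has_direct_sum Z Z'; exists W.
  split; first exact: subcat_sum ZZ'W SZ SZ'.
  have [i1 [i2 [p1 [p2 [e11 e22 e21 e12 _]]]]] := ZZ'W.
  exists (g \oc p1 - g' \oc p2), (i1 \oc h + i2 \oc h').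
  have E U V (a : mor U Y) (p : mor W U) (i : mor V W) (b : mor X V) :
    (a \oc p) \oc (i \oc b) = a \oc ((p \oc i) \oc b) by rewrite !compA.
  rewrite compDr !compBl !E e11 e22 e21 e12.
  by rewrite !comp0m !compm0 !comp1m subr0 sub0r.
- move=> X Y Z g _ [W [SW [k [h ->]]]]; exists W; split=> //.
  by exists (g \oc k), h; rewrite compA.
- move=> X Y Z _ f [W [SW [k [h ->]]]]; exists W; split=> //.
  by exists k, (h \oc f); rewrite compA.
Defined.

Definition cosemisimple : Prop :=
  forall (X Y : factor_cat subcat_ideal) (f : mor X Y),
    cat_jacobson f -> f = 0.

End Cosemisimple.

(* For i : 'I_n, the positions i and i + 1 in a chain indexed by 0, ..., n. *)
Definition lo n (i : 'I_n) : 'I_n.+1 := widen_ord (leqnSn n) i.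
Definition hi n (i : 'I_n) : 'I_n.+1 := lift ord0 i.

Section SubcatChains.
Variables (C : addcat) (n : nat) (S : 'I_n.+1 -> subcat C).

Definition subcat_chain : Prop :=
  [/\ forall X, S ord0 X,
      forall i : 'I_n, forall X, S (hi i) X -> S (lo i) X
    & forall X, S ord_max X -> zero_obj X].

Definition cosemisimple_step (i : 'I_n) : Prop :=
  cosemisimple (sub_in (S (lo i)) (S (hi i))).

Definition total_right_rejective_chain : Prop :=
  subcat_chain /\
  forall i : 'I_n, right_rejective (S (hi i)) /\ cosemisimple_step i.

Definition total_left_rejective_chain : Prop :=
  subcat_chain /\
  forall i : 'I_n, left_rejective (S (hi i)) /\ cosemisimple_step i.

Definition coreflective_chain : Prop :=
  subcat_chain /\
  forall i : 'I_n, cosemisimple_step i /\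
    coreflective (sub_in (S (lo i)) (S (hi i))).

Definition reflective_chain : Prop :=
  subcat_chain /\
  forall i : 'I_n, cosemisimple_step i /\
    reflective (sub_in (S (lo i)) (S (hi i))).

End SubcatChains.

Section LinHom.
Variable B : pzRingType.

Definition linhom (U V : lmodType B) : Type := {linear U -> V}.

Lemma linhom_eq (U V : lmodType B) (f g : {linear U -> V}) :
  (forall x, f x = g x) -> f = g :> linhom U V.
Proof.
case: f => f cf; case: g => g cg /= fg.
have {fg} : f = g by apply: funext.
move=> fg; subst g.
suff -> : cf = cg by [].
case: cf cg => [[a1] [a2]] [[b1] [b2]].
by rewrite (Prop_irrelevance a1 b1) (Prop_irrelevance a2 b2).
Qed.

Section Zmod.
Variables U V : lmodType B.

HB.instance Definition _ := gen_eqMixin (linhom U V).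
HB.instance Definition _ := gen_choiceMixin (linhom U V).

Definition linhom0 : linhom U V := (\0 : U -> V) : {linear U -> V}.
Definition linhomD (f g : linhom U V) : linhom U V :=
  ((f : {linear U -> V}) \+ (g : {linear U -> V}) : U -> V) : {linear U -> V}.
Definition linhomN (f : linhom U V) : linhom U V :=
  (\- (f : {linear U -> V}) : U -> V) : {linear U -> V}.

Lemma linhomDA : associative linhomD.
Proof. by move=> f g h; apply: linhom_eq => x /=; rewrite addrA. Qed.
Lemma linhomDC : commutative linhomD.
Proof. by move=> f g; apply: linhom_eq => x /=; rewrite addrC. Qed.
Lemma linhom0D : left_id linhom0 linhomD.
Proof. by move=> f; apply: linhom_eq => x /=; rewrite add0r. Qed.
Lemma linhomND : left_inverse linhom0 linhomN linhomD.
Proof. by move=> f; apply: linhom_eq => x /=; rewrite addNr. Qed.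

HB.instance Definition _ := GRing.isZmodule.Build (linhom U V)
  linhomDA linhomDC linhom0D linhomND.

End Zmod.

End LinHom.

Section ModCat.
Variable B : pzRingType.

Definition linhom_id (U : lmodType B) : linhom U U := (idfun : {linear U -> U}).
Definition linhom_comp (U V W : lmodType B) (g : linhom V W) (f : linhom U V) :
    linhom U W :=
  ((g : {linear V -> W}) \o (f : {linear U -> V}) : U -> W)
    : {linear U -> W}.

Definition modcat_pre : precat.
Proof.
apply: (@PreCat (lmodType B) (fun U V => linhom U V) linhom_id linhom_comp).
- by move=> U V f; apply: linhom_eq.
- by move=> U V f; apply: linhom_eq.
- by move=> U V W Z h g f; apply: linhom_eq.
- by move=> U V W g g' f; apply: linhom_eq.
- by move=> U V W g f f'; apply: linhom_eq => x /=; rewrite linearD.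
Defined.

Lemma modcat_has_zero : exists Z : modcat_pre, zero_obj Z.
Proof.
exists ('rV[B]_0 : lmodType B); apply: zero_obj_id; apply: linhom_eq => x /=.
by rewrite [LHS]thinmx0.
Qed.

Section Pair.
Variables U V : lmodType B.

Definition linhom_inl (x : U) : U * V := (x, 0).
Definition linhom_inr (x : V) : U * V := (0, x).

Lemma linhom_inl_linear : linear linhom_inl.
Proof. by move=> a x y; congr pair; rewrite /= scaler0 addr0. Qed.
Lemma linhom_inr_linear : linear linhom_inr.
Proof. by move=> a x y; congr pair; rewrite /= scaler0 addr0. Qed.

HB.instance Definition _ :=
  GRing.isLinear.Build B U (U * V)%type *:%R linhom_inl linhom_inl_linear.
HB.instance Definition _ :=
  GRing.isLinear.Build B V (U * V)%type *:%R linhom_inr linhom_inr_linear.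

Lemma modcat_direct_sum :
  @direct_sum modcat_pre U V ((U * V)%type : lmodType B).
Proof.
exists (linhom_inl : {linear U -> (U * V)%type}),
  (linhom_inr : {linear V -> (U * V)%type}),
  (fst : {linear (U * V)%type -> U}), (snd : {linear (U * V)%type -> V}).
split; apply: linhom_eq => // -[x y] /=.
by congr pair; rewrite /= ?addr0 ?add0r.
Qed.

End Pair.

Definition modcat : addcat :=
  @AddCat modcat_pre modcat_has_zero
    (fun U V => ex_intro _ _ (modcat_direct_sum U V)).

Definition fingen (M : lmodType B) : Prop :=
  exists (m : nat) (s : 'I_m -> M), forall x : M, exists c : 'I_m -> B,
    x = \sum_(i < m) c i *: s i.

Definition projective (M : lmodType B) : Prop :=
  forall (N L : lmodType B) (g : {linear N -> L}) (f : {linear M -> L}),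
    (forall y, exists x, g x = y) ->
    exists h : {linear M -> N}, forall x, g (h x) = f x.

Lemma fingen_sum (X Y Z : modcat) :
  direct_sum X Y Z -> fingen X -> fingen Y -> fingen Z.
Proof.
case=> [i1 [i2 [p1 [p2 [_ _ _ _ e]]]]] [m [s hs]] [m' [s' hs']].
exists (m + m')%N, (fun k => match split k with
  | inl a => (i1 : {linear _ -> _}) (s a)
  | inr b => (i2 : {linear _ -> _}) (s' b) end) => z.
have [c hc] := hs ((p1 : {linear _ -> _}) z).
have [c' hc'] := hs' ((p2 : {linear _ -> _}) z).
exists (fun k => match split k with inl a => c a | inr b => c' b end).
rewrite big_split_ord /=.
under eq_bigr => k _ do rewrite (unsplitK (inl k)) -linearZ.
under [X in _ + X]eq_bigr => k _ do rewrite (unsplitK (inr k)) -linearZ.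
rewrite -!linear_sum -hc -hc'.
by have /= := congr1 (fun f : linhom Z Z => (f : {linear _ -> _}) z) e.
Qed.

Lemma fingen_summand (X Z : modcat) :
  direct_summand X Z -> fingen Z -> fingen X.
Proof.
case=> [Y [i1 [i2 [p1 [p2 [e _ _ _ _]]]]]] [m [s hs]].
exists m, (fun k => (p1 : {linear _ -> _}) (s k)) => x.
have [c hc] := hs ((i1 : {linear _ -> _}) x); exists c.
under eq_bigr => k _ do rewrite -linearZ.
rewrite -linear_sum -hc.
by have /= := congr1 (fun f : linhom X X => (f : {linear _ -> _}) x) (esym e).
Qed.

Lemma projective_sum (X Y Z : modcat) :
  direct_sum X Y Z -> projective X -> projective Y -> projective Z.
Proof.
case=> [i1 [i2 [p1 [p2 [_ _ _ _ e]]]]] pX pY N L g f sg.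
have [h1 h1E] := pX N L g (linhom_comp (f : linhom Z L) i1) sg.
have [h2 h2E] := pY N L g (linhom_comp (f : linhom Z L) i2) sg.
exists (linhomD (linhom_comp (h1 : linhom X N) p1)
                (linhom_comp (h2 : linhom Y N) p2)) => x /=.
rewrite linearD h1E h2E /= -linearD; congr (f _).
by have /= := congr1 (fun f : linhom Z Z => (f : {linear _ -> _}) x) e.
Qed.

Lemma projective_summand (X Z : modcat) :
  direct_summand X Z -> projective Z -> projective X.
Proof.
case=> [Y [i1 [i2 [p1 [p2 [e _ _ _ _]]]]]] pZ N L g f sg.
have [h hE] := pZ N L g (linhom_comp (f : linhom X L) p1) sg.
exists (linhom_comp (h : linhom Z N) i1) => x /=.
rewrite hE /=; congr (f _).
by have /= := congr1 (fun f : linhom X X => (f : {linear _ -> _}) x) e.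
Qed.

Lemma zero_obj_mod (Z : modcat) : zero_obj Z -> forall x : Z, x = 0.
Proof.
move=> /(_ Z) [/(_ (linhom_id Z)) e _] x.
by have /= := congr1 (fun f : linhom Z Z => (f : {linear _ -> _}) x) e.
Qed.

Definition in_proj (M : modcat) : Prop := fingen M /\ projective M.

Lemma in_proj_zero (Z : modcat) : zero_obj Z -> in_proj Z.
Proof.
move=> Z0; split.
  exists 0%N, (fun _ => 0) => x; exists (fun _ => 0).
  by rewrite big_ord0; apply: zero_obj_mod.
move=> N L g f sg; exists (linhom0 Z N) => x /=.
by rewrite (zero_obj_mod Z0 x) !linear0.
Qed.

Lemma in_proj_summand (X Z : modcat) :
  direct_summand X Z -> in_proj Z -> in_proj X.
Proof.
move=> sXZ [fZ pZ].
by split; [apply: fingen_summand fZ | apply: projective_summand pZ].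
Qed.

Lemma in_proj_iso (X Y : modcat) (f : mor X Y) :
  isom f -> in_proj X -> in_proj Y.
Proof. by move=> isof; apply: in_proj_summand; apply: isom_summand isof. Qed.

Lemma in_proj_sum (X Y Z : modcat) :
  direct_sum X Y Z -> in_proj X -> in_proj Y -> in_proj Z.
Proof.
move=> XYZ [fX pX] [fY pY].
by split; [apply: fingen_sum fX fY | apply: projective_sum pX pY].
Qed.

Definition proj : subcat modcat :=
  SubCat in_proj_zero in_proj_iso in_proj_sum in_proj_summand.

End ModCat.

(* Right modules over A are left modules over the converse ring A^c; in
   particular a *: x = x * a in the right regular module (A^c)^o. *)

Section Submodules.
Variables (B : pzRingType) (M : lmodType B) (S : submodClosed M).

Definition submod : Type := {x : M | x \in S}.

HB.instance Definition _ := SubChoice.on submod.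
HB.instance Definition _ := [SubChoice_isSubLmodule of submod by <:].

Lemma submod_valP a (x y : submod) : val (a *: x + y) = a *: val x + val y.
Proof. by []. Qed.

End Submodules.

Record ideal (A : pzRingType) := Ideal {
  ideal_set :> set A;
  ideal0 : ideal_set 0;
  idealD : forall x y, ideal_set x -> ideal_set y -> ideal_set (x + y);
  idealMl : forall a x, ideal_set x -> ideal_set (a * x);
  idealMr : forall a x, ideal_set x -> ideal_set (x * a) }.

Section Ideals.
Variable A : pzRingType.

Definition setmul (P Q : set A) : set A :=
  [set x | exists (m : nat) (p q : 'I_m -> A),
    (forall i, P (p i) /\ Q (q i)) /\ x = \sum_(i < m) p i * q i].

Definition AeA (e : A) : set A := setmul (setmul setT [set e]) setT.

Definition maximal_right_ideal (m : submodClosed (A^c)^o) : Prop :=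
  (exists x, x \notin m) /\
  forall m' : submodClosed (A^c)^o,
    {subset m <= m'} -> (exists x, x \notin m') -> {subset m' <= m}.

Definition jacobson : set A :=
  [set x | forall m : submodClosed (A^c)^o, maximal_right_ideal m -> x \in m].

Variable I : ideal A.

Definition ideal_pred : {pred A} := fun x => `[< ideal_set I x >].
Definition left_pred : {pred A^o} := fun x => `[< ideal_set I x >].
Definition right_pred : {pred (A^c)^o} := fun x => `[< ideal_set I x >].

Lemma ideal_zmod : zmod_closed ideal_pred.
Proof.
split=> [|x y /asboolP Ix /asboolP Iy]; first exact/asboolP/ideal0.
by apply/asboolP/idealD => //; rewrite -mulN1r; apply: idealMl.
Qed.

Lemma left_submod : submod_closed left_pred.
Proof.
split=> [|a x y /asboolP Ix /asboolP Iy]; first exact/asboolP/ideal0.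
by apply/asboolP/idealD => //; apply: (@idealMl A I).
Qed.

Lemma right_submod : submod_closed right_pred.
Proof.
split=> [|a x y /asboolP Ix /asboolP Iy]; first exact/asboolP/ideal0.
by apply/asboolP/idealD => //; apply: (@idealMr A I).
Qed.

HB.instance Definition _ := GRing.isZmodClosed.Build A ideal_pred ideal_zmod.
HB.instance Definition _ :=
  GRing.isSubmodClosed.Build A A^o left_pred left_submod.
HB.instance Definition _ :=
  GRing.isSubmodClosed.Build A^c (A^c)^o right_pred right_submod.

Definition left_module : lmodType A := submod left_pred.
Definition right_module : lmodType A^c := submod right_pred.

Definition quot_ring : Type := Quotient.quot ideal_pred.

HB.instance Definition _ := GRing.Zmodule.on quot_ring.

Definition quot_pi (x : A) : quot_ring := \pi x.
Definition quot_repr (x : quot_ring) : A := repr x.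

Lemma quot_reprK x : quot_pi (quot_repr x) = x.
Proof. exact: reprK. Qed.

Lemma quot_piP x y : quot_pi x = quot_pi y <-> ideal_set I (x - y).
Proof.
have e := Quotient.idealrBE ideal_pred x y.
split=> [xy|Ixy].
  suff: x - y \in ideal_pred by move/asboolP.
  by rewrite e; apply/eqP.
by apply/eqP; rewrite -e; apply/asboolP.
Qed.

Lemma quot_piD x y : quot_pi (x + y) = quot_pi x + quot_pi y.
Proof. exact: raddfD. Qed.

Definition quot_one : quot_ring := quot_pi 1.
Definition quot_mul (x y : quot_ring) : quot_ring :=
  quot_pi (quot_repr x * quot_repr y).

Lemma quot_mulE x y : quot_mul (quot_pi x) (quot_pi y) = quot_pi (x * y).
Proof.
apply/quot_piP; set x' := quot_repr _; set y' := quot_repr _.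
have -> : x' * y' - x * y = (x' - x) * y' + x * (y' - y).
  by rewrite mulrBl mulrBr addrA subrK.
apply: idealD; [apply: idealMr | apply: idealMl];
  by apply/quot_piP; rewrite quot_reprK.
Qed.

Lemma quot_mulA : associative quot_mul.
Proof.
move=> x y z; rewrite -[x]quot_reprK -[y]quot_reprK -[z]quot_reprK.
by rewrite !quot_mulE mulrA.
Qed.

Lemma quot_mul1x : left_id quot_one quot_mul.
Proof. by move=> x; rewrite -[x]quot_reprK quot_mulE mul1r. Qed.

Lemma quot_mulx1 : right_id quot_one quot_mul.
Proof. by move=> x; rewrite -[x]quot_reprK quot_mulE mulr1. Qed.

Lemma quot_mulDl : left_distributive quot_mul +%R.
Proof.
move=> x y z; rewrite -[x]quot_reprK -[y]quot_reprK -[z]quot_reprK.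
by rewrite -quot_piD !quot_mulE mulrDl quot_piD.
Qed.

Lemma quot_mulDr : right_distributive quot_mul +%R.
Proof.
move=> x y z; rewrite -[x]quot_reprK -[y]quot_reprK -[z]quot_reprK.
by rewrite -quot_piD !quot_mulE mulrDr quot_piD.
Qed.

HB.instance Definition _ := GRing.Zmodule_isPzRing.Build quot_ring
  quot_mulA quot_mul1x quot_mulx1 quot_mulDl quot_mulDr.

(* The ideal (H + I) / I of A / I; it is H / I when I is contained in H. *)
Definition quot_ideal (H : ideal A) : ideal quot_ring.
Proof.
apply: (@Ideal quot_ring [set y | exists2 x, ideal_set H x & quot_pi x = y]).
- by exists 0; [apply: ideal0 | apply: raddf0].
- move=> _ _ [x Hx <-] [y Hy <-].
  by exists (x + y); [apply: idealD | apply: quot_piD].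
- move=> a _ [x Hx <-]; exists (quot_repr a * x); first exact: idealMl.
  by rewrite -quot_mulE quot_reprK.
- move=> a _ [x Hx <-]; exists (x * quot_repr a); first exact: idealMr.
  by rewrite -quot_mulE quot_reprK.
Defined.

End Ideals.

Definition idempotent_ideal (A : pzRingType) (H : ideal A) : Prop :=
  setmul H H = H.

Definition radical_vanishing (A : pzRingType) (H : ideal A) : Prop :=
  setmul (setmul H (@jacobson A)) H = [set 0].

Definition heredity_ideal (A : pzRingType) (H : ideal A) : Prop :=
  [/\ idempotent_ideal H, projective (right_module H)
    & radical_vanishing H].

Section HeredityChains.
Variables (A : pzRingType) (n : nat) (H : 'I_n.+1 -> ideal A).

Definition idempotent_ideal_chain : Prop :=
  [/\ H ord0 = setT :> set A,
      forall i : 'I_n, H (hi i) `<` H (lo i),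
      H ord_max = [set 0] :> set A
    & forall i, idempotent_ideal (H i)].

Definition heredity_chain : Prop :=
  idempotent_ideal_chain /\
  forall i : 'I_n, heredity_ideal (quot_ideal (H (hi i)) (H (lo i))).

Definition right_strongly_heredity_chain : Prop :=
  idempotent_ideal_chain /\
  forall i : 'I_n, projective (right_module (H (lo i))) /\
    radical_vanishing (quot_ideal (H (hi i)) (H (lo i))).

Definition left_strongly_heredity_chain : Prop :=
  idempotent_ideal_chain /\
  forall i : 'I_n, projective (left_module (H (lo i))) /\
    radical_vanishing (quot_ideal (H (hi i)) (H (lo i))).

End HeredityChains.

Definition artinian (R : comPzRingType) : Prop :=
  forall I : nat -> ideal R, (forall k, I k.+1 `<=` I k) ->
    exists N, forall k, (N <= k)%N -> I k = I N :> set R.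

(* An algebra over a commutative ring R is given by its structure map, a ring
   morphism from R to the center; unlike algType this allows the zero ring. *)
Definition artin_algebra (A : pzRingType) : Prop :=
  exists (R : comPzRingType) (phi : {rmorphism R -> A}),
    [/\ artinian R,
        forall r a, phi r * a = a * phi r
      & exists (m : nat) (s : 'I_m -> A), forall a, exists c : 'I_m -> R,
          a = \sum_(i < m) phi (c i) * s i].

Section IdempotentModules.
Variable A : pzRingType.

Definition eA_pred (e : A) : {pred (A^c)^o} :=
  fun x => `[< exists a : A, x = e * a >].

Lemma eA_submod e : submod_closed (eA_pred e).
Proof.
split=> [|a x y /asboolP[b ->] /asboolP[c ->]].
  by apply/asboolP; exists 0; rewrite mulr0.
by apply/asboolP; exists (b * a + c); rewrite mulrDr mulrA.
Qed.

HB.instance Definition _ e :=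
  GRing.isSubmodClosed.Build A^c (A^c)^o (eA_pred e) (eA_submod e).

Definition eA (e : A) : lmodType A^c := submod (eA_pred e).

Lemma eA_proj (e : A) : e * e = e -> proj A^c (eA e : modcat A^c).
Proof.
move=> ee.
have ePe : e \in eA_pred e by apply/asboolP; exists 1; rewrite mulr1.
pose u : eA e := exist _ e ePe.
have uE (x : eA e) : (val x : A^c) *: u = x.
  apply: val_inj; case/asboolP: (valP x) => a ax.
  rewrite [LHS](_ : _ = e * val x :> A) //.
  by rewrite -[RHS]/(val x) ax mulrA ee.
split.
  exists 1%N, (fun _ => u) => x; exists (fun _ => val x).
  by rewrite big_ord1 uE.
move=> N L g f sg; have [y gy] := sg (f u).
pose h (x : eA e) : N := (val x : A^c) *: y.
have hlin : linear h.
  by move=> a x z; rewrite /h submod_valP scalerDl -scalerA.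
exists (HB.pack_for {linear eA e -> N} h
  (GRing.isLinear.Build A^c (eA e) N *:%R h hlin)) => x /=.
by rewrite linearZ gy -linearZ uE.
Qed.

Lemma add_eA_proj (e : A) (X : modcat A^c) :
  e * e = e -> add (eA e : modcat A^c) X -> proj A^c X.
Proof.
move=> ee [m [Z [eZ XZ]]]; apply: subcat_summand XZ _.
exact: subcat_power (eA_proj ee) eZ.
Qed.

Definition projcat : addcat := full (proj A^c).

(* By add_eA_proj, for e idempotent this is all of add eA. *)
Definition add_eA (e : A) : subcat projcat :=
  sub_in (proj A^c) (add (eA e : modcat A^c)).

End IdempotentModules.

(* Main.v *)
From HB Require Import structures.
From mathcomp Require Import all_boot all_algebra.
From mathcomp Require Import boolp classical_sets.
Require Import Defs.

(* Everything is reduced to finite dual bases inside the ring. Since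
   Hom(gA, fA) = fAg, the subcategory add gA is coreflective in add fA iff fAg is
   finitely generated projective over gAg, that is, has a finite dual basis; the
   counit is moreover monic for f = 1 iff the coordinate functions extend to AgA,
   that is, iff AgA is a projective right ideal. The dual statements are the same
   ones over the opposite ring and in the opposite category. Cosemisimplicity says
   that the corner of A / H_(i+1) at e_i has zero radical.

   The substantial implication is (iii) => (i). If H_i is projective, its
   coreflection eps : Y -> H_i in add e_(i+1)A has image H_(i+1) and a kernel K with
   K H_(i+1) = 0. As H_j / H_(j+1) is projective over A / H_(j+1) for j > i, the
   image of K in Y H_j / Y H_(j+1) is a direct summand of a module generated by H_j,
   yet it is annihilated by H_j; so K is contained in Y H_j for all j, and K = 0.

   On the left one also needs that heredity ideals are left-right symmetric, which
   holds because eBe is semisimple when it is artinian with zero radical. *)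

Set Implicit Arguments.
Unset Strict Implicit.
Unset Printing Implicit Defensive.

Import GRing.Theory.
Local Open Scope ring_scope.

(** * Dual bases of corners *)

Section Corners.
Variable A : pzRingType.
Implicit Types (e f g w x : A).

(** Coordinate functions are not assumed additive or linear: [lin_on] only asks that they preserve
    relations [\sum_j x j * b j = 0]. For w = g this contains additivity and gAg-linearity; for
    general w it makes sum x_j b_j |-> sum c(x_j) b_j well defined on fAgAw, so the computations
    stay inside the ring. On the categorical side wA is the test object: w = g makes the counit
    cancellable against maps out of add gA, and w = 1 against all maps. One construction of a
    universal arrow therefore yields both coreflections and right rejections, and (iii) => (i)
    becomes the passage from w = g to w = 1. The artin hypothesis enters through two finiteness
    facts: AgA is finitely generated on either side, so its projectivity is witnessed by a finite
    dual basis; and finite powers of eBe satisfy the descending chain condition, which gives the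
    left-right symmetry. *)

Definition corner f g x : Prop := x = f * x * g.

Lemma corner_l f g x : f * f = f -> corner f g x -> f * x = x.
Proof. by move=> ff xE; rewrite xE !mulrA ff. Qed.

Lemma corner_r f g x : g * g = g -> corner f g x -> x * g = x.
Proof. by move=> gg xE; rewrite {1}xE -mulrA gg -xE. Qed.

Lemma corner_mk f g x : f * f = f -> g * g = g -> corner f g (f * x * g).
Proof. by move=> ff gg; rewrite /corner -!mulrA gg !mulrA ff. Qed.

Lemma corner1 f x : f * f = f -> corner 1 f (x * f).
Proof. by move=> ff; rewrite /corner mul1r -mulrA ff. Qed.

Lemma cornerr1 f x : f * f = f -> corner f 1 (f * x).
Proof. by move=> ff; rewrite /corner mulr1 mulrA ff. Qed.

Lemma corner_sum f g (J : finType) (x : J -> A) :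
  (forall j, corner f g (x j)) -> corner f g (\sum_j x j).
Proof.
by move=> xP; rewrite /corner mulr_sumr mulr_suml; apply: eq_bigr => j _; apply: xP.
Qed.

Lemma cornerM f g h x y : f * f = f -> h * h = h ->
  corner f g x -> corner g h y -> corner f h (x * y).
Proof.
move=> ff hh xP yP; rewrite /corner mulrA (corner_l ff xP) -mulrA.
by rewrite (corner_r hh yP).
Qed.

(** Sums are indexed by arbitrary finite types, so that they combine over sums and products of index
    types without renumbering ordinals. *)
Definition in_AeA e x : Prop :=
  exists (J : finType) (a b : J -> A), x = \sum_j a j * e * b j.

Lemma AeAP e x : AeA e x <-> in_AeA e x.
Proof.
split=> [[m [p [q [pqP ->]]]]|[J [a [b ->]]]].
  have /choice [P PP] (i : 'I_m) : exists a, p i = a * e.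
    have [[k [r [t [rtP ->]]]] _] := pqP i.
    exists (\sum_j r j); rewrite mulr_suml; apply: eq_bigr => j _.
    by have [_ ->] := rtP j.
  by exists 'I_m, P, q; apply: eq_bigr => i _; rewrite PP.
exists #|J|, (fun i => a (enum_val i) * e), (fun i => b (enum_val i)).
split=> [i|]; last by rewrite (reindex _ (onW_bij _ (enum_val_bij J))).
split=> //; exists 1%N, (fun=> a (enum_val i)), (fun=> e).
by split=> //; rewrite big_ord1.
Qed.

Lemma in_AeA1 e x y : in_AeA e (x * e * y).
Proof. by exists unit, (fun=> x), (fun=> y); rewrite big_const card_unit /= addr0. Qed.

Lemma in_AeA_id e : in_AeA e e.
Proof. by have := in_AeA1 e 1 1; rewrite mul1r mulr1. Qed.

Lemma in_AeA0 e : in_AeA e 0.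
Proof. by have := in_AeA1 e 0 0; rewrite mulr0. Qed.

Lemma in_AeAD e x y : in_AeA e x -> in_AeA e y -> in_AeA e (x + y).
Proof.
move=> [J [a [b ->]]] [J' [a' [b' ->]]]; exists (J + J')%type.
exists (fun j => match j with inl j => a j | inr j => a' j end).
exists (fun j => match j with inl j => b j | inr j => b' j end).
by rewrite big_sumType.
Qed.

Lemma in_AeA_mul e x y z : in_AeA e x -> in_AeA e (y * x * z).
Proof.
move=> [J [a [b ->]]]; exists J, (fun j => y * a j), (fun j => b j * z).
by rewrite mulr_sumr mulr_suml; apply: eq_bigr => j _; rewrite !mulrA.
Qed.

Lemma in_AeAMl e x y : in_AeA e x -> in_AeA e (y * x).
Proof. by move/(in_AeA_mul y 1); rewrite mulr1. Qed.

Lemma in_AeAMr e x y : in_AeA e x -> in_AeA e (x * y).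
Proof. by move/(in_AeA_mul 1 y); rewrite mul1r. Qed.

Lemma in_AeA_sum e (J : finType) (x : J -> A) :
  (forall j, in_AeA e (x j)) -> in_AeA e (\sum_j x j).
Proof. by move=> xP; elim/big_ind: _ => //; [apply: in_AeA0 | apply: in_AeAD]. Qed.

Lemma in_AeA_trans e f x : in_AeA f e -> in_AeA e x -> in_AeA f x.
Proof.
by move=> fe [J [a [b ->]]]; apply: in_AeA_sum => j; apply: in_AeA_mul.
Qed.

Definition lin_on f g w (c : A -> A) : Prop :=
  forall (J : finType) (x b : J -> A), (forall j, corner f g (x j)) ->
    (forall j, corner g w (b j)) ->
    \sum_j x j * b j = 0 -> \sum_j c (x j) * b j = 0.

(* A finite dual basis of the right gAg-module fAg whose coordinate functions
   extend to the right module fAgAw: for w = g this says that fAg is a finitely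
   generated projective gAg-module, and for f = w = 1 that AgA is a finitely
   generated projective right ideal. *)
Definition dual_basis f g w : Prop :=
  exists (I : finType) (u : I -> A) (c : I -> A -> A),
    [/\ forall k, corner f g (u k),
        forall k x, corner f g x -> corner g g (c k x),
        forall x, corner f g x -> x = \sum_k u k * c k x
      & forall k, lin_on f g w (c k)].

(** The difference of two representations is a relation over the disjoint union of their index
    types. *)
Lemma lin_on_eq f g w c : lin_on f g w c ->
  forall (J J' : finType) (x b : J -> A) (x' b' : J' -> A),
    (forall j, corner f g (x j)) -> (forall j, corner g w (b j)) ->
    (forall j, corner f g (x' j)) -> (forall j, corner g w (b' j)) ->
    \sum_j x j * b j = \sum_j x' j * b' j ->
    \sum_j c (x j) * b j = \sum_j c (x' j) * b' j.
Proof.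
move=> lc J J' x b x' b' xP bP xP' bP' E; apply/eqP; rewrite -subr_eq0; apply/eqP.
pose X (j : J + J') := match j with inl j => x j | inr j => x' j end.
pose Y (j : J + J') := match j with inl j => b j | inr j => - b' j end.
have sN (z : J' -> A) : \sum_j z j * - b' j = - \sum_j z j * b' j.
  by rewrite -sumrN; apply: eq_bigr => j _; rewrite mulrN.
have := lc _ X Y; rewrite !big_sumType /= !sN; apply; last by rewrite E subrr.
  by case.
by case=> j //=; rewrite /corner mulrN mulNr -bP'.
Qed.

(** fAg is a direct summand of Ag through left multiplication by f: the generators are multiplied by
    f and the coordinates restricted. *)
Lemma dual_basis_corner f g : f * f = f -> g * g = g ->
  dual_basis 1 g 1 -> dual_basis f g g.
Proof.
move=> ff gg [I [u [c [uP cP uc lc]]]].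
have c1 x : corner f g x -> corner 1 g x.
  by move=> xP; rewrite -(corner_r gg xP); apply: corner1.
exists I, (fun k => f * u k), c; split=> [k|k x xP|x xP|k J x b xP bP].
- by rewrite -(corner_r gg (uP k)) mulrA; apply: corner_mk.
- exact/cP/c1.
- rewrite -{1}(corner_l ff xP) {1}[x in f * x]uc; last exact: c1.
  by rewrite mulr_sumr; apply: eq_bigr => k _; rewrite mulrA.
apply: lc => j; first exact: c1.
by rewrite -(corner_l gg (bP j)); apply: cornerr1.
Qed.

(** An expression 1 = sum a_j f b_j is itself a dual basis, with generators a_j f and coordinates x
    |-> f b_j x f. *)
Lemma dual_basis_full f : f * f = f -> in_AeA f 1 -> dual_basis 1 f 1.
Proof.
move=> ff [J [a [b E]]].
exists J, (fun j => a j * f), (fun j x => f * b j * x * f).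
split=> [k|k x xP|x xP|k I x y xP yP].
- exact: corner1.
- by rewrite -(mulrA f); apply: corner_mk.
- rewrite -{1}[x]mul1r E mulr_suml; apply: eq_bigr => j _.
  by rewrite -!mulrA (mulrA f f) ff (corner_r ff xP).
move/(congr1 ( *%R (f * b k))); rewrite mulr0 mulr_sumr; apply: etrans.
by apply: eq_bigr => i _; rewrite -!mulrA (corner_l ff (yP i)).
Qed.

Lemma dual_basis0 : dual_basis 1 0 1.
Proof.
exists void, (of_void A), (fun k => of_void (A -> A) k).
by split=> [[]|[]|x ->|[]]; rewrite mulr0 big_pred0 // => -[].
Qed.

(** Coreflections compose. As g = sum p_t f q_t, the coordinates of Af extend to Ag through x = sum
    (x p_t f)(f q_t g); the extensions [phi k] take values in fAg, where the second dual basis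
    applies. *)
Lemma dual_basis_trans f g : f * f = f -> g * g = g -> in_AeA f g ->
  dual_basis 1 f 1 -> dual_basis f g g -> dual_basis 1 g g.
Proof.
move=> ff gg [T [p [q gE]]] [I [u [c [uP cP uc lc]]]] [I' [u' [c' [uP' cP' uc' lc']]]].
pose phi k x := \sum_t c k (x * p t * f) * (f * q t * g).
have phiP k x : corner f g (phi k x).
  apply: corner_sum => t; apply: cornerM => //; first exact/cP/corner1.
  exact: corner_mk.
have phi_lin (k : I) (J : finType) (x b : J -> A) :
    (forall j, corner 1 g (x j)) -> (forall j, corner g g (b j)) ->
    \sum_j x j * b j = 0 -> \sum_j phi k (x j) * b j = 0.
  move=> xP bP xb0.
  have := lc k (J * T)%type (fun z => x z.1 * p z.2 * f)
    (fun z => f * q z.2 * g * b z.1).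
  move=> /(_ (fun=> corner1 _ ff)).
  have bP' (z : J * T) : corner f 1 (f * q z.2 * g * b z.1).
    by rewrite -!mulrA; apply: cornerr1.
  move=> /(_ bP') E; apply: etrans (E _).
    rewrite -(pair_bigA _ (fun j t => c k (x j * p t * f) * (f * q t * g * b j))) /=.
    by apply: eq_bigr => j _; rewrite mulr_suml; apply: eq_bigr => t _; rewrite !mulrA.
  rewrite -(pair_bigA _ (fun j t => x j * p t * f * (f * q t * g * b j))) /=.
  rewrite -[RHS]xb0; apply: eq_bigr => j _.
  rewrite -{2}(corner_l gg (bP j)) {2}gE mulr_suml mulr_sumr; apply: eq_bigr => t _.
  by rewrite -!mulrA (mulrA f f) ff (corner_l gg (bP j)).
have phiE x : corner 1 g x -> x = \sum_k u k * phi k x.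
  move=> xP; rewrite -{1}(corner_r gg xP) -{1}gg {1}gE mulr_suml mulr_sumr.
  under [RHS]eq_bigr => k _ do rewrite mulr_sumr.
  rewrite exchange_big; apply: eq_bigr => t _ /=.
  under eq_bigr => k _ do rewrite mulrA.
  rewrite -mulr_suml -uc; last exact: corner1.
  by rewrite -!mulrA (mulrA f f) ff.
exists (I * I')%type, (fun z => u z.1 * u' z.2), (fun z x => c' z.2 (phi z.1 x)).
split=> [z|z x xP|x xP|z J x b xP bP xb0].
- by apply: cornerM => //; rewrite mulr1.
- exact: cP'.
- rewrite -(pair_bigA _ (fun k l => u k * u' l * c' l (phi k x))) /= {1}(phiE x xP).
  apply: eq_bigr => k _; rewrite {1}[phi k x]uc' // mulr_sumr.
  by apply: eq_bigr => l _; rewrite mulrA.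
- by apply: lc' => //; apply: phi_lin.
Qed.

End Corners.

(** A bare function with properties, rather than [quot_ring], so that the same p also serves as a
    quotient map between the converse rings. *)
Definition quotient_map (A B : pzRingType) (p : A -> B) (g : A) : Prop :=
  [/\ {morph p : x y / x + y}, {morph p : x y / x * y}, p 1 = 1,
      forall y, exists x, p x = y & forall x, p x = 0 <-> in_AeA g x].

Section QuotientMap.
Variables (A B : pzRingType) (p : A -> B) (g : A) (qp : quotient_map p g).

Lemma quotient_map0 : p 0 = 0.
Proof. by have [_ _ _ _ ker] := qp; apply/ker/in_AeA0. Qed.

Lemma quotient_mapD : {morph p : x y / x + y}.
Proof. by have [] := qp. Qed.

Lemma quotient_mapM : {morph p : x y / x * y}.
Proof. by have [] := qp. Qed.

Lemma quotient_mapB : {morph p : x y / x - y}.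
Proof.
by move=> x y; apply: (addIr (p y)); rewrite -quotient_mapD !subrK.
Qed.

Lemma quotient_map_sum (J : finType) (x : J -> A) :
  p (\sum_j x j) = \sum_j p (x j).
Proof. exact: (big_morph p quotient_mapD quotient_map0). Qed.

Lemma quotient_mapP x y : p x = p y <-> in_AeA g (x - y).
Proof.
have [_ _ _ _ ker] := qp; rewrite -ker quotient_mapB; split=> [->|].
  by rewrite subrr.
by move/eqP; rewrite subr_eq0 => /eqP.
Qed.

Lemma quotient_map_idem : p g = 0.
Proof. by have [_ _ _ _ ker] := qp; apply/ker/in_AeA_id. Qed.

(** The coordinate functions, extended to AfA, carry AgA into itself: since g = ggg and g lies in
    AfA, an element of AgA is a sum of terms (a' g a f)(f b g b'), and the right-hand factor, which
    contains g, survives. *)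
Lemma dual_basis_quotient f : f * f = f -> g * g = g -> in_AeA f g ->
  dual_basis 1 f 1 -> dual_basis 1 (p f) 1.
Proof.
move=> ff gg [T [a [b gE]]] [I [u [c [uP cP uc lc]]]].
have [_ _ p1 /choice [s sK] ker] := qp.
have pff : p f * p f = p f by rewrite -quotient_mapM ff.
have sf y : corner 1 (p f) y -> p (s y * f) = y.
  by move=> yP; rewrite quotient_mapM sK (corner_r pff yP).
have fs y : corner (p f) 1 y -> p (f * s y) = y.
  by move=> yP; rewrite quotient_mapM sK (corner_l pff yP).
have pc x y z : corner x y z -> corner (p x) (p y) (p z).
  by move=> zE; rewrite /corner -!quotient_mapM -zE.
exists I, (p \o u), (fun k y => p (c k (s y * f))).
split=> [k|k y yP|y yP|k J y z yP zP yz0].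
- by rewrite -p1; apply: pc.
- exact/pc/cP/corner1.
- rewrite -{1}(sf y yP) {1}(uc (s y * f)); last exact: corner1.
  by rewrite quotient_map_sum; apply: eq_bigr => k _; rewrite quotient_mapM.
have /ker [T' [a' [b' E]]] : p (\sum_j (s (y j) * f) * (f * s (z j))) = 0.
  rewrite quotient_map_sum -[RHS]yz0; apply: eq_bigr => j _.
  by rewrite quotient_mapM sf ?fs.
have := lin_on_eq (lc k) (x' := fun t : T' * T => a' t.1 * g * a t.2 * f)
  (b' := fun t => f * (b t.2 * g * b' t.1)) (fun j => corner1 (s (y j)) ff)
  (fun j => cornerr1 (s (z j)) ff).
move=> /(_ (fun=> corner1 _ ff) (fun=> cornerr1 _ ff)) F.
have /(congr1 p) : \sum_j c k (s (y j) * f) * (f * s (z j)) =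
   \sum_(t : T' * T) c k (a' t.1 * g * a t.2 * f) * (f * (b t.2 * g * b' t.1)).
  apply: F; rewrite E -(pair_bigA _ (fun j t =>
    a' j * g * a t * f * (f * (b t * g * b' j)))) /=.
  apply: eq_bigr => j _.
  rewrite -{1}gg -{1}gg {2}gE !(mulr_suml, mulr_sumr); apply: eq_bigr => t _.
  by rewrite -!mulrA (mulrA f f) ff.
rewrite !quotient_map_sum => {}F; apply: etrans (etrans F _).
  by apply: eq_bigr => j _; rewrite quotient_mapM fs.
apply: big1 => t _.
by rewrite !quotient_mapM quotient_map_idem mulr0 mul0r !mulr0.
Qed.

End QuotientMap.

(** * The kernel of the coreflection of A *)

Section Descent.
Variables (A : pzRingType) (g : A) (I : finType) (u : I -> A) (c : I -> A -> A).
Hypotheses (gg : g * g = g) (uP : forall k, corner 1 g (u k)).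
Hypothesis cP : forall k x, corner 1 g x -> corner g g (c k x).
Hypothesis uc : forall x, corner 1 g x -> x = \sum_k u k * c k x.
Hypothesis lc : forall k, lin_on 1 g g (c k).

(* Y is the image of the idempotent matrix (c k (u l)) acting on (gA)^I; eps maps
   it onto AgA, and AgA is projective as soon as eps is injective. *)
Definition inY (y : I -> A) : Prop := forall k, y k = \sum_l c k (u l) * y l.
Definition eps (y : I -> A) : A := \sum_k u k * y k.
Definition inK (y : I -> A) : Prop := inY y /\ eps y = 0.

Lemma inY_coord x b : corner 1 g x -> inY (fun k => c k x * b).
Proof.
move=> xP k; under eq_bigr => l _ do rewrite mulrA.
rewrite -mulr_suml; congr (_ * b).
(* Two representations of x are compared: the single term x g and the expansion sum u_l c_l(x). *)
have := lin_on_eq (lc k) (x := fun _ : unit => x) (b := fun=> g) (x' := u)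
  (b' := fun l => c l x) (fun=> xP).
rewrite !(big_const, card_unit) /= !addr0 (corner_r gg xP).
rewrite (corner_r gg (cP k xP)); apply => //.
- by move=> _; rewrite /corner !gg.
- by move=> l; apply: cP.
- exact: uc.
Qed.

Lemma eps_coord x b : corner 1 g x -> eps (fun k => c k x * b) = x * b.
Proof.
move=> xP; rewrite [in RHS](uc xP) mulr_suml.
by apply: eq_bigr => k _; rewrite mulrA.
Qed.

Lemma inY_sum (J : finType) (y : J -> I -> A) :
  (forall j, inY (y j)) -> inY (fun k => \sum_j y j k).
Proof.
move=> yY k; under [RHS]eq_bigr => l _ do rewrite mulr_sumr.
by rewrite exchange_big; apply: eq_bigr => j _; apply: yY.
Qed.

Lemma eps_sum (J : finType) (y : J -> I -> A) :
  eps (fun k => \sum_j y j k) = \sum_j eps (y j).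
Proof.
by rewrite exchange_big; apply: eq_bigr => k _; rewrite mulr_sumr.
Qed.

Lemma inYMr y b : inY y -> inY (fun k => y k * b).
Proof.
by move=> yY k; rewrite [y k]yY mulr_suml; apply: eq_bigr => l _; rewrite mulrA.
Qed.

Lemma epsMr y b : eps (fun k => y k * b) = eps y * b.
Proof. by rewrite mulr_suml; apply: eq_bigr => l _; rewrite mulrA. Qed.

Lemma inYB y z : inY y -> inY z -> inY (fun k => y k - z k).
Proof.
move=> yY zY k; rewrite [y k]yY [z k]zY -sumrB.
by apply: eq_bigr => l _; rewrite mulrBr.
Qed.

Lemma epsB y z : eps (fun k => y k - z k) = eps y - eps z.
Proof. by rewrite -sumrB; apply: eq_bigr => l _; rewrite mulrBr. Qed.

Lemma eps_onto x : in_AeA g x -> exists2 y, inY y & eps y = x.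
Proof.
move=> [J [a [b ->]]]; exists (fun k => \sum_j c k (a j * g) * b j).
  by apply: inY_sum => j; apply/inY_coord/corner1.
by rewrite eps_sum; apply: eq_bigr => j _; apply/eps_coord/corner1.
Qed.

(** The preimage can be taken in YAfA: it suffices to lift each a_j f and multiply the lift by f
    b_j. *)
Lemma eps_onto_ideal f x : f * f = f -> in_AeA g f -> in_AeA f x ->
  exists y, [/\ inY y, eps y = x & forall k, in_AeA f (y k)].
Proof.
move=> ff gf [J [a [b ->]]].
have /choice [y yP] j : exists y, inY y /\ eps y = a j * f.
  by have [y] := eps_onto (in_AeAMl (a j) gf); exists y.
exists (fun k => \sum_j y j k * (f * b j)); split=> [|| k].
- by apply: inY_sum => j; apply: inYMr; have [] := yP j.
- rewrite eps_sum; apply: eq_bigr => j _; have [_ yE] := yP j.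
  by rewrite epsMr yE -mulrA (mulrA f f) ff mulrA.
by apply: in_AeA_sum => j; rewrite mulrA; apply: in_AeA1.
Qed.

(** Right multiplication by a g brings the coordinates of y into gAg, where the relation eps y = 0
    is of the kind that [lin_on 1 g g] preserves. *)
Lemma inK_annihilated y x k : inK y -> in_AeA g x -> y k * x = 0.
Proof.
move=> [yY yE] [J [a [b ->]]]; rewrite mulr_sumr; apply: big1 => j _.
suff E : y k * a j * g = 0 by rewrite !mulrA E mul0r.
rewrite [y k]yY !mulr_suml; under eq_bigr => l _ do rewrite -!mulrA (mulrA (y l)).
have yg l : g * y l = y l.
  rewrite [y l]yY mulr_sumr; apply: eq_bigr => m _.
  by rewrite mulrA (corner_l gg (cP l (uP m))).
apply: (lc k uP) => [l|].
  by rewrite -(yg l) -(mulrA g); apply: corner_mk.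
rewrite -[RHS](mul0r (a j * g)) -{2}yE mulr_suml.
by apply: eq_bigr => l _; rewrite !mulrA.
Qed.

(* YAfA / YAf'A splits as the image of K plus a copy of AfA / Af'A, and it is
   generated by AfA, which annihilates K; so the image of K vanishes. *)
Lemma inK_descends (B : pzRingType) (p : A -> B) f f' y :
  f * f = f -> f' * f' = f' ->
  in_AeA g f -> in_AeA f f' -> quotient_map p f' -> dual_basis 1 (p f) 1 ->
  inK y -> (forall k, in_AeA f (y k)) -> forall k, in_AeA f' (y k).
Proof.
move=> ff ff' gf ff'A qp [T [v [d [vP dP vd ld]]]] yK yf k; have [yY yE] := yK.
have [pD pM p1 /choice [s sK] ker] := qp.
have pff : p f * p f = p f by rewrite -pM ff.
have /choice [Jab abE] l : exists Jab : {J : finType & (J -> A) * (J -> A)}%type,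
    y l = \sum_j (projT2 Jab).1 j * f * (projT2 Jab).2 j.
  by have [J [a [b E]]] := yf l; exists (existT _ J (a, b)).
pose J l := projT1 (Jab l); pose ab l := projT2 (Jab l).
(* The number of terms a f b needed for [y l] depends on l, so all terms are gathered in a dependent
   sum. *)
pose Z : finType := {l : I & J l}.
pose a (z : Z) := (ab (tag z)).1 (tagged z).
pose b (z : Z) := (ab (tag z)).2 (tagged z).
have sumZ (w : I -> A) : \sum_l w l * y l = \sum_z w (tag z) * (a z * f * b z).
  rewrite (eq_bigr (fun l => \sum_j w l * ((ab l).1 j * f * (ab l).2 j))).
    exact: sig_big_dep.
  by move=> l _; rewrite abE mulr_sumr.
(* Lifting the generators v_t to Y gives a section of eps modulo Af'A. *)
have /choice [la laP] t : exists la, inY la /\ p (eps la) = v t.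
  have [la Yla E] := eps_onto (in_AeAMl (s (v t)) gf).
  by exists la; rewrite E pM sK (corner_r pff (vP t)).
pose x z := u (tag z) * (a z * f).
(* The component of the z-th generator in the kernel of eps modulo Af'A: the generator minus the
   section applied to its image. *)
pose ka z m := c m (u (tag z)) * (a z * f) - \sum_t la t m * s (d t (p (x z))).
have kaY z : inY (ka z).
  apply: inYB; first exact: inY_coord.
  by apply: inY_sum => t; apply: inYMr; have [] := laP t.
have xP z : corner 1 (p f) (p (x z)).
  by rewrite /corner mul1r -pM /x -!mulrA ff.
have eps_ka z : in_AeA f' (eps (ka z)).
  apply/ker; rewrite epsB eps_coord // eps_sum (quotient_mapB qp).
  rewrite (quotient_map_sum qp) [X in X - _](vd _ (xP z)) -sumrB; apply: big1 => t _.
  by rewrite (epsMr (la t)) pM sK; have [_ ->] := laP t; rewrite subrr.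
have gf' : in_AeA g f' by apply: in_AeA_trans ff'A.
(* [mu z] has entries in Af'A and the same image as [ka z]. Their difference lies in K, so right
   multiplication by f b_z cannot tell them apart. *)
have /choice [mu muP] z := eps_onto_ideal ff' gf' (eps_ka z).
have kamu z : ka z k * (f * b z) = mu z k * (f * b z).
  have [muY muE _] := muP z.
  have kamuK : inK (fun m => ka z m - mu z m).
    by split; [apply: inYB | rewrite epsB muE subrr].
  have := inK_annihilated k kamuK (in_AeAMr (b z) gf).
  by rewrite mulrBl => /eqP; rewrite subr_eq0 => /eqP.
(* The first sum lies in Af'A; the second is the section applied to the coordinates of eps y = 0,
   which vanish modulo Af'A. *)
have -> : y k = \sum_z mu z k * (f * b z) +
    \sum_t la t k * \sum_z s (d t (p (x z))) * (f * b z).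
  rewrite [y k]yY sumZ; under [X in _ + X]eq_bigr => t _ do rewrite mulr_sumr.
  rewrite exchange_big -big_split; apply: eq_bigr => z _ /=.
  rewrite -kamu mulrBl mulr_suml.
  under [X in _ - X + _]eq_bigr => t _ do rewrite -mulrA.
  by rewrite subrK -!mulrA (mulrA f f) ff.
apply: in_AeAD; first by apply: in_AeA_sum => z; apply: in_AeAMr; have [] := muP z.
apply: in_AeA_sum => t; apply/in_AeAMl/ker; rewrite (quotient_map_sum qp).
under eq_bigr => z _ do rewrite pM sK.
apply: ld => // [z|]; first by rewrite pM; apply: cornerr1.
under eq_bigr => z _ do rewrite -pM.
rewrite -(quotient_map_sum qp) -[RHS](quotient_map0 qp) -{2}yE /eps sumZ.
by congr p; apply: eq_bigr => z _; rewrite /x -!mulrA (mulrA f f) ff.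
Qed.

End Descent.

(** For a relation sum x_j b_j = 0 with b_j in gA, the column of the sums sum_j c_k(x_j) b_j lies in
    K; so K = 0 raises w = g to w = 1. The hypothesis ranges over all dual bases because
    [dual_basis] hides its witness. *)
Lemma dual_basis_from_corner (A : pzRingType) (g : A) : g * g = g ->
  dual_basis 1 g g ->
  (forall (I : finType) (u : I -> A) (c : I -> A -> A),
    [/\ forall k, corner 1 g (u k),
        forall k x, corner 1 g x -> corner g g (c k x),
        forall x, corner 1 g x -> x = \sum_k u k * c k x
      & forall k, lin_on 1 g g (c k)] ->
    forall y, inK u c y -> forall k, y k = 0) ->
  dual_basis 1 g 1.
Proof.
move=> gg [I [u [c ucP]]] K0; exists I, u, c; have [uP cP uc lc] := ucP.
split=> // k J x b xP bP xb0.
apply: (K0 I u c ucP (fun k => \sum_j c k (x j) * b j)); split.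
  by apply: (inY_sum (y := fun j k => c k (x j) * b j)) => j;
    apply: (inY_coord gg uP cP uc lc).
rewrite (eps_sum u (fun j k => c k (x j) * b j)) -[RHS]xb0.
by apply: eq_bigr => j _; apply: (eps_coord uc).
Qed.

(** * Induction along the chain *)

Section RingChain.
Variables (A : pzRingType) (n : nat) (e : 'I_n.+1 -> A) (B : 'I_n -> pzRingType).
Variable p : forall i : 'I_n, A -> B i.
Hypotheses (ee : forall i, e i * e i = e i) (e0 : in_AeA (e ord0) 1).
Hypotheses (en : e ord_max = 0) (eS : forall i : 'I_n, in_AeA (e (lo i)) (e (hi i))).
Hypothesis pP : forall i, quotient_map (p i) (e (hi i)).

Lemma chain_ind (P : 'I_n.+1 -> Prop) :
  P ord0 -> (forall i : 'I_n, P (lo i) -> P (hi i)) -> forall i, P i.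
Proof.
move=> P0 PS [m mn]; elim: m mn => [|m IH] mn.
  by rewrite (_ : Ordinal mn = ord0) //; apply: val_inj.
have mn' : (m < n)%N by [].
rewrite (_ : Ordinal mn = hi (Ordinal mn')); last exact: val_inj.
apply: PS; rewrite (_ : lo _ = Ordinal (ltnW mn)) //; exact: val_inj.
Qed.

Lemma chain_le (i j : 'I_n.+1) : (i <= j)%N -> in_AeA (e i) (e j).
Proof.
elim/chain_ind: j => [|j IH].
  rewrite leqn0 => /eqP i0.
  by rewrite (_ : i = ord0); [apply: in_AeA_id | apply: val_inj].
rewrite leq_eqVlt => /orP[/eqP/val_inj ->|ij]; first exact: in_AeA_id.
apply: in_AeA_trans (eS j); apply: IH; by rewrite -ltnS.
Qed.

(** This is (i) <=> (iii) with the radical conditions, common to both, set aside. *)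
Theorem dual_basis_chain :
  (forall i, dual_basis 1 (e i) 1) <->
  (forall i : 'I_n, dual_basis 1 (p i (e (lo i))) 1 /\
     dual_basis (e (lo i)) (e (hi i)) (e (hi i))).
Proof.
split=> [db i|db].
  split; last exact: dual_basis_corner.
  exact: (dual_basis_quotient (pP i)).
elim/chain_ind => [|i IH]; first exact: dual_basis_full.
apply: dual_basis_from_corner => //.
  by apply: dual_basis_trans IH _ => //; case: (db i).
move=> I u c [uP cP uc lc] y yK k.
(* At j = n the idempotent is 0, which forces y = 0. The induction starts at j = i + 1, where the
   matrix entries c_k(u_l) already lie in gAg. *)
suff H (j : 'I_n.+1) : (hi i <= j)%N -> forall k, in_AeA (e j) (y k).
  have [J [a [b ->]]] : in_AeA 0 (y k) by rewrite -en; apply: H; apply: leq_ord.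
  by apply: big1 => j _; rewrite mulr0 mul0r.
elim/chain_ind: j => [//|j IHj]; rewrite leq_eqVlt => /orP[/eqP/val_inj <- {}k|].
  case: yK => yY _; rewrite [y k]yY; apply: in_AeA_sum => l; apply: in_AeAMr.
  by rewrite -(corner_r (ee _) (cP k _ (uP l))); apply/in_AeAMl/in_AeA_id.
rewrite ltnS => ij; have [dj _] := db j.
have {}ij : (hi i <= lo j)%N by [].
apply: (inK_descends (ee _) uP cP uc lc (ee _) (ee _)
  (chain_le ij) (eS j) (pP j) dj yK).
exact: IHj.
Qed.

End RingChain.

(** * Projective one-sided ideals *)

(** The mirror image of [dual_basis 1 g 1], spelled out in products of B: at B = A it concerns left
    ideals, at B = A^c right ideals. *)
Definition left_dual_basis (B : pzRingType) (g : B) : Prop :=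
  exists (I : finType) (u : I -> B) (c : I -> B -> B),
    [/\ forall k, u k = g * u k,
        forall k y, y = g * y -> c k y = g * c k y * g,
        forall y, y = g * y -> y = \sum_k c k y * u k
      & forall k (J : finType) (b y : J -> B),
          (forall j, b j = b j * g) -> (forall j, y j = g * y j) ->
          \sum_j b j * y j = 0 -> \sum_j b j * c k (y j) = 0].

Lemma mulcE (A : pzRingType) (x y : A) : (x : A^c) * (y : A^c) = y * x.
Proof. by []. Qed.

Lemma left_dual_basisE (B : pzRingType) (g : B) :
  left_dual_basis g <-> @dual_basis B^c 1 g 1.
Proof.
have E1 (x : B) : @corner B^c 1 g x <-> x = g * x.
  by rewrite /corner mul1r; split; exact id.
have E2 (x : B) : @corner B^c g 1 x <-> x = x * g.
  by rewrite /corner mulr1; split; exact id.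
split=> -[I [u [c [uP cP uc lc]]]]; exists I, u, c; split.
- by move=> k; apply/E1.
- move=> k x /E1 xP; exact: etrans (cP k x xP) (esym (mulrA g (c k x) g)).
- by move=> x /E1; apply: uc.
- move=> k J x b xP bP; apply: (lc k J b x) => j; first exact/E2.
  exact/E1.
- by move=> k; apply/E1.
- move=> k x /E1 xP; exact: etrans (cP k x xP) (mulrA g (c k x) g).
- by move=> x /E1; apply: uc.
- move=> k J b y bP yP; apply: (lc k J y b) => j; first exact/E1.
  exact/E2.
Qed.

Lemma left_dual_basisE_conv (A : pzRingType) (g : A) :
  @left_dual_basis A^c g <-> dual_basis 1 g 1.
Proof.
have E1 (x : A) : corner 1 g x <-> x = x * g.
  by rewrite /corner mul1r; split; exact id.
have E2 (x : A) : corner g 1 x <-> x = g * x.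
  by rewrite /corner mulr1; split; exact id.
split=> -[I [u [c [uP cP uc lc]]]]; exists I, u, c; split.
- by move=> k; apply/E1/uP.
- move=> k x /E1 xP; exact: etrans (cP k x xP) (mulrA g (c k x) g).
- by move=> x /E1; apply: uc.
- move=> k J x b xP bP; apply: (lc k J b x) => j; first exact/E2.
  exact/E1.
- by move=> k; apply/E1/uP.
- move=> k x /E1 xP; exact: etrans (cP k x xP) (esym (mulrA g (c k x) g)).
- by move=> x /E1; apply: uc.
- move=> k J b y bP yP; apply: (lc k J y b) => j; first exact/E1.
  exact/E2.
Qed.

(** The coordinates are those of a splitting of the surjection from B^m onto M. *)
Lemma projective_coord (B : pzRingType) (M : lmodType B) m (s : 'I_m -> M) :
  (forall x, exists c : 'I_m -> B, x = \sum_i c i *: s i) -> projective M ->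
  exists d : 'I_m -> M -> B,
    (forall k a x y, d k (a *: x + y) = a * d k x + d k y) /\
    (forall x, x = \sum_k d k x *: s k).
Proof.
move=> gen pM.
pose F (r : 'rV[B]_m) : M := \sum_k r 0 k *: s k.
have Fl : linear F.
  move=> a x y; rewrite /F scaler_sumr -big_split; apply: eq_bigr => k _ /=.
  by rewrite !mxE scalerDl scalerA.
pose lF : {linear 'rV[B]_m -> M} := HB.pack_for {linear 'rV[B]_m -> M} F
  (GRing.isLinear.Build B 'rV[B]_m M *:%R F Fl).
have [|h hE] := pM _ _ lF (linhom_id M).
  move=> y; have [c ->] := gen y; exists (\row_k c k).
  by apply: eq_bigr => k _; rewrite mxE.
exists (fun k x => h x 0 k); split=> [k a x y|x]; last by rewrite -{1}[x]hE.
by rewrite linearP !mxE.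
Qed.

Lemma coord_projective (B : pzRingType) (M : lmodType B) (I : finType)
    (s : I -> M) (d : I -> M -> B) :
  (forall k a x y, d k (a *: x + y) = a * d k x + d k y) ->
  (forall x, x = \sum_k d k x *: s k) -> projective M.
Proof.
move=> dl dE N L g f sg; have /choice [t tE] k := sg (f (s k)).
pose h x := \sum_k d k x *: t k.
have hl : linear h.
  move=> a x y; rewrite /h scaler_sumr -big_split; apply: eq_bigr => k _ /=.
  by rewrite dl scalerDl scalerA.
exists (HB.pack_for {linear M -> N} h (GRing.isLinear.Build B M N *:%R h hl)).
move=> x /=; rewrite /h [in RHS](dE x) !linear_sum; apply: eq_bigr => k _.
by rewrite !linearZ tE.
Qed.

Section IdealProjective.
Variables (B : pzRingType) (S : submodClosed B^o) (g : B) (m : nat) (t : 'I_m -> B).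
Hypotheses (gg : g * g = g) (SE : forall x : B, (x \in S) <-> in_AeA g x).
Hypothesis gen : forall x, in_AeA g x -> exists a : 'I_m -> B, x = \sum_k a k * (g * t k).

Let s k : submod S := Sub (g * t k)
  (proj2 (SE (g * t k)) (in_AeAMr (t k) (in_AeA_id g))).

Lemma val_submod_sum (I : finType) (a : I -> B) (x : I -> submod S) :
  val (\sum_i a i *: x i) = \sum_i a i * (val (x i) : B).
Proof. by elim/big_ind2: _ => // x1 x2 y1 y2 <- <-. Qed.

(** Coordinates on BgB restrict to gB, and a further factor g puts them in gBg without changing the
    expansion, the generators being g t_k. Conversely [lin_on] lets coordinates on gB extend by sum
    b_j y_j |-> sum b_j c_k(y_j). *)
Lemma ideal_projectiveP : projective (submod S) <-> left_dual_basis g.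
Proof.
have s_gen (x : submod S) : exists c : 'I_m -> B, x = \sum_k c k *: s k.
  have [a E] := gen (proj1 (SE _) (valP x)); exists a.
  by apply: val_inj; rewrite val_submod_sum.
split=> [/(projective_coord s_gen) [d [dl dE]]|[I [u [c [uP cP uc lc]]]]].
  have d0 k : d k 0 = 0.
    by have := dl k (-1) 0 0; rewrite scaler0 addr0 mulN1r addNr.
  have dZ k a x : d k (a *: x) = a * d k x.
    by have := dl k a x 0; rewrite !addr0 d0 addr0.
  have dD k x y : d k (x + y) = d k x + d k y.
    by have := dl k 1 x y; rewrite scale1r mul1r.
  have dS k (J : finType) (x : J -> submod S) : d k (\sum_j x j) = \sum_j d k (x j).
    exact: (big_morph (d k) (dD k) (d0 k)).
  have gS y : y = g * y -> y \in S.
    by move=> ->; apply/SE/in_AeAMr/in_AeA_id.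
  (* The default 0 is taken only outside the ideal, where [D] is never evaluated. *)
  pose D k y := d k (insubd (0 : submod S) y).
  have DZ k a y : y = g * y -> D k (a * y) = a * D k y.
    move=> /gS yS; rewrite /D -dZ; congr (d k _); apply: val_inj.
    rewrite insubdK; last by apply/SE/in_AeAMl/SE.
    by rewrite [RHS](_ : _ = a * (val (insubd (0 : submod S) y) : B)) // insubdK.
  exists 'I_m, (fun k => g * t k), (fun k y => D k y * g).
  split=> [k|k y yP|y yP|k J b y bP yP by0].
  - by rewrite mulrA gg.
  - by rewrite -mulrA -mulrA gg mulrA -DZ // -yP.
  - have := congr1 val (dE (insubd (0 : submod S) y)).
    rewrite val_submod_sum insubdK ?gS // => {1}->; apply: eq_bigr => k _.
    by rewrite -mulrA (mulrA g g) gg.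
  under eq_bigr => j _ do rewrite mulrA.
  rewrite -mulr_suml.
  under eq_bigr => j _ do rewrite /D -dZ.
  rewrite -dS [X in d k X](_ : _ = 0) ?d0 ?mul0r //.
  apply: val_inj; rewrite val_submod_sum [RHS](_ : _ = (0 : B)) // -[RHS]by0.
  by apply: eq_bigr => j _; rewrite insubdK //; apply: gS.
(* A chosen representation of every x in the ideal (empty elsewhere); [DE] below shows that the
   extension does not depend on it. *)
have /choice [K KP] (x : B) : exists z : {J : finType & (J -> B) * (J -> B)}%type,
    x \in S -> x = \sum_j ((projT2 z).1 j * g) * (g * (projT2 z).2 j).
  case: (pselect (x \in S)) => [/SE [J [a [b E]]]|xS].
    exists (existT _ J (a, b)) => _; rewrite {1}E; apply: eq_bigr => j _ /=.
    by rewrite -!mulrA (mulrA g g) gg.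
  by exists (existT _ (void : finType) (of_void B, of_void B)).
pose D k x := \sum_j ((projT2 (K x)).1 j * g) * c k (g * (projT2 (K x)).2 j).
have DE k x (J : finType) (b y : J -> B) : x \in S ->
    (forall j, b j = b j * g) -> (forall j, y j = g * y j) ->
    x = \sum_j b j * y j -> D k x = \sum_j b j * c k (y j).
  move=> xS bP yP xE; apply/eqP; rewrite -subr_eq0 -sumrN; apply/eqP.
  pose J' := projT1 (K x).
  pose X (j : J' + J) := match j with inl j => (projT2 (K x)).1 j * g | inr j => - b j end.
  pose Y (j : J' + J) := match j with inl j => g * (projT2 (K x)).2 j | inr j => y j end.
  have := lc k _ X Y; rewrite !big_sumType /=.
  under [X in _ -> _ -> _ -> _ + X = _]eq_bigr => j _ do rewrite mulNr.
  apply.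
  - by case=> j /=; rewrite -?mulrA ?gg // mulNr -bP.
  - by case=> j /=; rewrite ?mulrA ?gg // -yP.
  - rewrite -(KP x xS) {1}xE -big_split; apply: big1 => j _ /=.
    by rewrite mulNr subrr.
have uS k : u k \in S by apply/SE; rewrite uP; apply/in_AeAMr/in_AeA_id.
apply: (@coord_projective B (submod S) I (fun k => Sub (u k) (uS k))
  (fun k (x : submod S) => D k (val x))).
  move=> k a x y.
  pose J := (projT1 (K (val x)) + projT1 (K (val y)))%type.
  rewrite (DE k _ J (fun j => match j with
    | inl j => a * ((projT2 (K (val x))).1 j * g)
    | inr j => (projT2 (K (val y))).1 j * g end)
   (fun j => match j with
    | inl j => g * (projT2 (K (val x))).2 j
    | inr j => g * (projT2 (K (val y))).2 j end)).
  - rewrite big_sumType /=; congr (_ + _); rewrite mulr_sumr.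
    by apply: eq_bigr => j _; rewrite -!mulrA.
  - exact: valP.
  - by case=> j; rewrite -!mulrA gg.
  - by case=> j; rewrite mulrA gg.
  - rewrite big_sumType /= -(KP _ (valP y)) [LHS](_ : _ = a * val x + val y) //.
    congr (_ + _); rewrite {1}(KP _ (valP x)) mulr_sumr.
    by apply: eq_bigr => j _; rewrite -!mulrA.
move=> x; apply: val_inj; rewrite val_submod_sum /= {1}(KP _ (valP x)).
under [RHS]eq_bigr => k _ do rewrite mulr_suml.
rewrite exchange_big; apply: eq_bigr => j _ /=.
rewrite {1}[g * _]uc; last by rewrite mulrA gg.
by rewrite mulr_sumr; apply: eq_bigr => k _; rewrite mulrA.
Qed.

End IdealProjective.

(** * Semisimple corners *)

Section ArtinianFree.
Variables (R : comPzRingType) (T : finType) (P : nat -> (T -> R) -> Prop).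
Hypotheses (P0 : forall k, P k (fun=> 0))
  (PD : forall k r a b, P k a -> P k b -> P k (fun t => a t + r * b t)).

(** The echelon ideals of the k-th submodule of R^T, with T ordered by its enumeration. *)
Definition leading_ideal (k : nat) (t : T) : ideal R.
Proof.
apply: (@Ideal R (fun r => exists c, [/\ P k c, c t = r &
  forall s, (enum_rank s < enum_rank t)%N -> c s = 0])).
- by exists (fun=> 0).
- move=> x y [a [Pa <- az]] [b [Pb <- bz]].
  exists (fun t => a t + 1 * b t); split; [exact: PD | by rewrite mul1r |].
  by move=> s st; rewrite az // bz // mulr0 addr0.
- move=> r x [a [Pa <- az]]; exists (fun t => 0 + r * a t).
  split; [exact: PD | by rewrite add0r |].
  by move=> s st; rewrite az // mulr0 addr0.
- move=> r x [a [Pa <- az]]; exists (fun t => 0 + r * a t).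
  split; [exact: PD | by rewrite add0r mulrC |].
  by move=> s st; rewrite az // mulr0 addr0.
Defined.

(** The finitely many chains of echelon ideals become stationary together, and nested submodules
    with equal echelon ideals coincide. *)
Lemma artinian_free_dcc : artinian R -> (forall k c, P k.+1 c -> P k c) ->
  exists N, forall k, (N <= k)%N -> forall c, P N c -> P k c.
Proof.
move=> hR dec.
have mono k l c : (k <= l)%N -> P l c -> P k c.
  move=> /subnK <-; elim: (l - k)%N => [//|d IH] Pc.
  by apply/IH/dec; rewrite addSn in Pc.
have /choice [N NP] t : exists N, forall k, (N <= k)%N ->
    leading_ideal k t = leading_ideal N t :> set R.
  apply: hR => k r [c [Pc ct cz]]; exists c; split=> //; exact: dec.
pose M := \max_t N t; exists M => k Mk c Pc.
have lead t : leading_ideal k t = leading_ideal M t :> set R.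
  have NM : (N t <= M)%N by apply: leq_bigmax.
  by rewrite (NP t k) ?(NP t M) //; apply: leq_trans Mk.
(* Approximation of c inside the smaller submodule, one coordinate at a time: the leading entry of c
   - c' is also a leading entry there. *)
suff H d : exists2 c', P k c' & forall s, (enum_rank s < d)%N -> c s = c' s.
  have [c' Pc' E] := H #|T|; rewrite (_ : c = c') //.
  by apply: funext => s; apply: E.
elim: d => [|d [c' Pc' E]]; first by exists (fun=> 0).
case: (ltnP d #|T|) => [dT|Td]; last first.
  by exists c' => // s sd; apply: E; apply: leq_trans Td.
pose t := enum_val (Ordinal dT).
have tE : enum_rank t = d :> nat by rewrite /t enum_valK.
have [b [Pb bt bz]] : ideal_set (leading_ideal k t) (c t - c' t).
  rewrite lead; exists (fun s => c s + -1 * c' s); split.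
  - by apply: PD => //; apply: mono Pc'.
  - by rewrite mulN1r.
  - by move=> s; rewrite tE => sd; rewrite E // mulN1r subrr.
exists (fun s => c' s + 1 * b s); first exact: PD.
move=> s; rewrite ltnS leq_eqVlt => /orP[/eqP sd|sd].
  have -> : s = t by apply: enum_rank_inj; apply: ord_inj; rewrite tE.
  by rewrite bt mul1r addrC subrK.
by rewrite bz ?tE // mulr0 addr0 E.
Qed.

End ArtinianFree.

Lemma dcc_minimal (X : Type) (Q : (X -> Prop) -> Prop) (C0 : X -> Prop) :
  (forall N : nat -> X -> Prop, (forall k, Q (N k)) ->
     (forall k x, N k.+1 x -> N k x) ->
     exists K, forall k, (K <= k)%N -> forall x, N K x -> N k x) ->
  Q C0 ->
  exists2 C, Q C & forall C', Q C' -> (forall x, C' x -> C x) ->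
    forall x, C x -> C' x.
Proof.
move=> dcc Q0; apply: contrapT => noC.
have /choice [F FP] (C : {C | Q C}) : exists C' : {C | Q C},
    (forall x, sval C' x -> sval C x) /\ exists2 x, sval C x & ~ sval C' x.
  apply: contrapT => noC'; apply: noC; exists (sval C); first exact: svalP.
  move=> C' QC' C'C x Cx; apply: contrapT => nC'x; apply: noC'.
  by exists (exist _ C' QC'); split=> //; exists x.
pose N k := iter k F (exist _ C0 Q0).
have [K KP] := dcc (fun k => sval (N k)) (fun k => svalP (N k))
  (fun k => proj1 (FP (N k))).
have [_ [x Nx nNx]] := FP (N K).
exact/nNx/(KP K.+1).
Qed.

(** The ring eBe, with unit e, has zero Jacobson radical; the radical is described by invertibility
    of e - yb, as in [cat_jacobson]. *)
Definition semiprimitive_corner (B : pzRingType) (e : B) : Prop :=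
  forall b, corner e e b ->
    (forall y, corner e e y ->
      exists z, [/\ corner e e z, z * (e - y * b) = e & (e - y * b) * z = e]) ->
    b = 0.

Section Semisimple.
Variables (B : pzRingType) (e : B).
Hypotheses (ee : e * e = e) (sp : semiprimitive_corner e).

Lemma cornerDM a b c : corner e e a -> corner e e b -> corner e e c ->
  corner e e (a + b * c).
Proof.
move=> aP bP cP; rewrite /corner mulrDr mulrDl -aP; congr (_ + _).
exact: (cornerM ee ee bP cP).
Qed.

Lemma corner_id : corner e e e.
Proof. by rewrite /corner !ee. Qed.

Lemma cornerN a : corner e e a -> corner e e (- a).
Proof. by move=> aP; rewrite /corner mulrN mulNr -aP. Qed.

(** Left inverses suffice: a left inverse z of e - yb equals e - (-zy)b, so it has a left inverse
    too and is therefore two-sided. *)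
Lemma corner_radical0 b : corner e e b ->
  (forall y, corner e e y -> exists2 z, corner e e z & z * (e - y * b) = e) ->
  b = 0.
Proof.
move=> bP linv; apply: sp => // y yP; have [z zP zE] := linv y yP.
have [z' z'P z'E] := linv (- (z * y)) (cornerN (cornerM ee ee zP yP)).
have zE' : z = e - - (z * y) * b.
  rewrite mulNr opprK -[LHS](corner_r ee zP).
  by rewrite -{1}[e in _ * e](subrK (y * b)) mulrDr zE mulrA.
rewrite -zE' in z'E; exists z; split=> //; rewrite -[RHS]z'E; congr (_ * z).
have -> : z' = z' * (z * (e - y * b)) by rewrite zE (corner_r ee z'P).
by rewrite mulrA z'E mulrBr ee mulrA (corner_l ee yP).
Qed.


Variables (R : comPzRingType) (phi : {rmorphism R -> B}) (m : nat) (s : 'I_m -> B).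
Hypotheses (hR : artinian R) (phiC : forall r a, phi r * a = a * phi r).
Hypothesis gen : forall a, exists c : 'I_m -> R, a = \sum_i phi (c i) * s i.

Let T := 'I_m.
Let rho (x : T -> B) : B := \sum_t x t * (e * s t).

Let submodule (C : (T -> B) -> Prop) : Prop :=
  [/\ forall x, C x -> forall t, corner e e (x t), C (fun=> 0)
    & forall a x y, corner e e a -> C x -> C y -> C (fun t => x t + a * y t)].

Let covers (C : (T -> B) -> Prop) : Prop :=
  submodule C /\
  forall y, (forall t, corner e e (y t)) -> exists2 x, C x & rho x = rho y.

Lemma corner_phi r : corner e e (phi r * e).
Proof. by rewrite /corner mulrA -phiC -!mulrA !ee. Qed.

(** The map [psi], with generators e s_i e, presents (eBe)^T as a quotient of a free R-module of
    finite rank, to which the chain is pulled back. *)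
Lemma submodule_dcc (N : nat -> (T -> B) -> Prop) :
  (forall k, submodule (N k)) -> (forall k x, N k.+1 x -> N k x) ->
  exists K, forall k, (K <= k)%N -> forall x, N K x -> N k x.
Proof.
move=> subN decN.
pose psi (c : T * T -> R) (t : T) := \sum_i phi (c (t, i)) * (e * s i * e).
have psiD r a b : psi (fun z => a z + r * b z) = fun t => psi a t + (phi r * e) * psi b t.
  apply: funext => t; rewrite /psi mulr_sumr -big_split; apply: eq_bigr => i _ /=.
  rewrite rmorphD rmorphM mulrDl; congr (_ + _).
  by rewrite -!mulrA; congr (_ * _); rewrite [RHS]mulrA -phiC -!mulrA (mulrA e e) ee.
have [|||K KP] := @artinian_free_dcc R (T * T)%type (fun k c => N k (psi c)) _ _ hR.
- move=> k; have [_ N0 _] := subN k; rewrite (_ : psi _ = fun=> 0) //.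
  by apply: funext => t; rewrite /psi big1 // => i _; rewrite rmorph0 mul0r.
- move=> k r a b Na Nb; have [_ _ NS] := subN k; rewrite psiD.
  by apply: NS => //; apply: corner_phi.
- by move=> k c; apply: decN.
exists K => k Kk x Nx; have /choice [c cE] t := gen (x t).
have xE : x = psi (fun z => c z.1 z.2).
  apply: funext => t; have [NF _ _] := subN K; rewrite (NF _ Nx t) cE.
  rewrite mulr_sumr mulr_suml; apply: eq_bigr => i _ /=.
  by rewrite mulrA -phiC -!mulrA.
by rewrite xE; apply: KP => //; rewrite -xE.
Qed.

(* Take C minimal among the submodules of (eBe)^T that rho maps onto eB. By
   minimality the kernel of rho on C is superfluous, hence lies in the radical,
   which is zero; so rho maps C isomorphically onto eB. *)
Lemma semisimple_left_dual_basis : dual_basis 1 e 1 -> left_dual_basis e.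
Proof.
move=> [I [u [c [uP cP uc lc]]]].
have [||C [[CF C0 CS] Ccov] Cmin] := dcc_minimal (Q := covers)
   (C0 := fun x => forall t, corner e e (x t)).
- by move=> N NP; apply: submodule_dcc => k; have [] := NP k.
- split; last by move=> y yP; exists y.
  split=> // [t|a x y aP xP yP t]; first by rewrite /corner mulr0 mul0r.
  exact: cornerDM.
have rhoD a x y : rho (fun t => x t + a * y t) = rho x + a * rho y.
  rewrite /rho mulr_sumr -big_split; apply: eq_bigr => t _ /=.
  by rewrite mulrDl -(mulrA a).
have rho_inj x : C x -> rho x = 0 -> forall t, x t = 0.
  move=> Cx x0 t; apply: corner_radical0 => [|y yP]; first exact: CF.
  (* Subtracting (w_t y) x from w leaves [rho] unchanged and moves w into [D], so [D] still covers.
     By minimality x lies in [D], and x_t = a(e - y x_t) gives the left inverse e + ya of e - y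
     x_t. *)
  pose D w := C w /\ exists2 a, corner e e a & w t = a * (e - y * x t).
  have D_covers : covers D.
    split; first split.
    - by move=> w [/CF].
    - by split=> //; exists 0; rewrite ?mul0r // /corner mulr0 mul0r.
    - move=> a v w aP [Cv [b bP vE]] [Cw [d dP wE]]; split; first exact: CS.
      by exists (b + a * d); [apply: cornerDM | rewrite vE wE mulrA -mulrDl].
    move=> v vP; have [w Cw wE] := Ccov v vP.
    have wyP : corner e e (- (w t * y)).
      by apply: cornerN; apply: (cornerM ee ee (CF w Cw t) yP).
    exists (fun i => w i + - (w t * y) * x i); last by rewrite rhoD x0 mulr0 addr0.
    split; first exact: CS.
    exists (w t); first exact: CF.
    by rewrite mulrBr (corner_r ee (CF w Cw t)) mulNr mulrA.
  have [//|_ [a aP xE]] := Cmin D D_covers _ x Cx; first by move=> w [].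
  exists (e + y * a); first exact: cornerDM corner_id yP aP.
  by rewrite mulrDl -mulrA -xE mulrBr ee mulrA (corner_l ee yP) subrK.
(* The inverse of [rho] on C; its coordinates will be the coordinate functions of eB. *)
have /choice [tau tauP] y : exists x, y = e * y -> C x /\ rho x = y.
  case: (pselect (y = e * y)) => [yE|]; last by exists (fun=> 0).
  have [r rE] := gen y.
  have [|x Cx xE] := Ccov (fun t => phi (r t) * e); first by move=> t; apply: corner_phi.
  exists x => _; split=> //; rewrite xE [RHS]yE rE mulr_sumr; apply: eq_bigr => t _.
  by rewrite -mulrA (mulrA e e) ee mulrA phiC mulrA.
exists 'I_m, (fun t => e * s t), (fun t y => tau y t).
split=> [t|t y /tauP[Cx _]|y /tauP[_ /esym] //|t J b y bP yP by0].
- by rewrite mulrA ee.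
- exact: CF.
(* The b_j lie in Be, whereas C is only stable under eBe. The right dual basis of Be replaces them
   by c_l(b_j) in eBe and preserves the relation, so injectivity of [rho] on C applies. *)
have W0 l : \sum_j c l (b j) * tau (y j) t = 0.
  have CE (r : seq J) : C (fun t => \sum_(j <- r) c l (b j) * tau (y j) t) /\
     rho (fun t => \sum_(j <- r) c l (b j) * tau (y j) t) =
     \sum_(j <- r) c l (b j) * y j.
    elim: r => [|j r [IHC IHr]].
      rewrite big_nil (_ : (fun t => _) = fun=> 0); last first.
        by apply: funext => i; rewrite big_nil.
      by split=> //; rewrite /rho big1 // => i _; rewrite mul0r.
    rewrite big_cons -IHr (_ : (fun t => _) = fun t =>
      \sum_(j <- r) c l (b j) * tau (y j) t + c l (b j) * tau (y j) t); last first.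
      by apply: funext => i; rewrite big_cons addrC.
    have [Ct rt] := tauP (y j) (yP j).
    split; first by apply: CS => //; apply: cP; rewrite /corner mul1r.
    by rewrite rhoD rt addrC.
  have [CW rW] := CE (index_enum J).
  apply: (rho_inj _ CW); rewrite rW; apply: lc => // j; rewrite /corner.
    by rewrite mul1r.
  by rewrite mulr1.
have -> : \sum_j b j * tau (y j) t = \sum_l u l * \sum_j c l (b j) * tau (y j) t.
  under [RHS]eq_bigr => l _ do rewrite mulr_sumr.
  rewrite exchange_big; apply: eq_bigr => j _ /=.
  rewrite {1}[b j]uc; last by rewrite /corner mul1r.
  by rewrite mulr_suml; apply: eq_bigr => l _; rewrite mulrA.
by apply: big1 => l _; rewrite W0 mulr0.
Qed.

End Semisimple.

Lemma artin_converse (A : pzRingType) : artin_algebra A -> artin_algebra A^c.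
Proof.
move=> [R [phi [hR phiC gen]]].
pose psi : R -> A^c := phi.
have psiA : zmod_morphism psi by move=> x y; apply: (rmorphB phi).
have psiM : monoid_morphism psi.
  split=> [|x y]; first exact: (rmorph1 phi).
  by apply: etrans (rmorphM phi x y) _; apply: phiC.
pose psi' : {rmorphism R -> A^c} := HB.pack_for {rmorphism R -> A^c} psi
  (GRing.isZmodMorphism.Build _ _ psi psiA) (GRing.isMonoidMorphism.Build _ _ psi psiM).
exists R, psi'; split=> // [r a|]; first exact/esym/phiC.
have [m [s sP]] := gen; exists m, s => a; have [c ->] := sP a; exists c.
by apply: eq_bigr => i _; apply: phiC.
Qed.

(** Passing to the converse ring exchanges yb and by; the inverse of e - yb is e + yzb. *)
Lemma corner_inverse_swap (B : pzRingType) (e b y z : B) : e * e = e ->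
  corner e e b -> corner e e y -> corner e e z ->
  (e - b * y) * z = e -> z * (e - b * y) = e ->
  exists z, [/\ corner e e z, z * (e - y * b) = e & (e - y * b) * z = e].
Proof.
move=> ee bP yP zP z1 z2.
have [ey eb be] := And3 (corner_l ee yP) (corner_l ee bP) (corner_r ee bP).
exists (e + y * (z * b)); split.
- exact: cornerDM (corner_id ee) yP (cornerM ee ee zP bP).
- have E : z * b * y = z - e.
    by rewrite -[X in z - X]z2 mulrBr (corner_r ee zP) opprB addrC subrK mulrA.
  rewrite mulrDl !mulrBr ee (mulrA e) ey -!(mulrA y) (corner_r ee (cornerM ee ee zP bP)).
  by rewrite (mulrA (z * b)) E mulrBl eb mulrBr opprB [X in _ + X]addrC !subrK.
have E : b * y * z = z - e.
  by rewrite -[X in z - X]z1 mulrBl (corner_l ee zP) opprB addrC subrK.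
rewrite mulrDr !mulrBl ee (mulrA e y) ey -(mulrA y b e) be.
have -> : y * b * (y * (z * b)) = y * ((b * y * z) * b) by rewrite !mulrA.
by rewrite E mulrBl eb mulrBr opprB [X in _ + X]addrC !subrK.
Qed.

Lemma semiprimitive_corner_converse (B : pzRingType) (e : B) :
  e * e = e -> semiprimitive_corner e -> @semiprimitive_corner B^c e.
Proof.
move=> ee sp b bP linv.
have cE (x : B) : @corner B^c e e x <-> corner e e x by rewrite /corner mulcE mulrA.
apply: sp; first exact/cE.
move=> y yP; have [z [/cE zP z1 z2]] := linv y (proj2 (cE y) yP).
by apply: (@corner_inverse_swap B e b y z) => //; apply/cE.
Qed.

(** * The Jacobson radical *)

Section Jacobson.
Variable A : pzRingType.

Lemma right_ideal_mulr (m : submodClosed (A^c)^o) (x : A) a :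
  x \in m -> x * a \in m.
Proof. by move=> xm; apply: (rpredZ (a : A^c) xm). Qed.

Lemma submodClosed_of_set (M : set A) : M 0 ->
  (forall x y a, M x -> M y -> M (x * a + y)) ->
  exists m : submodClosed (A^c)^o, forall x, x \in m <-> M x.
Proof.
move=> M0 MD; pose p : {pred (A^c)^o} := fun x => `[< M x >].
have pP : submod_closed p.
  split=> [|a x y /asboolP Mx /asboolP My]; apply/asboolP => //.
  exact: MD.
exists (HB.pack_for (submodClosed (A^c)^o) p
  (GRing.isSubmodClosed.Build A^c (A^c)^o p pP)) => x.
by split=> /asboolP.
Qed.

Lemma exists_maximal_right_ideal (t : A) : (forall z, t * z <> 1) ->
  exists2 m : submodClosed (A^c)^o, maximal_right_ideal m & t \in m.
Proof.
move=> nt.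
(* Neither 0 nor t is required to lie in X, because Zorn's lemma is also applied to the empty chain.
   Both are recovered afterwards, since tA + (M with 0) again satisfies [P] and hence lies in the
   maximal M. *)
pose P (X : set A) := (forall x y a, X x -> X y -> X (x * a + y)) /\
  (forall x a, X x -> t * a + x <> 1).
have [|M [[MD M1] Mmax]] := @Zorn_bigcup A P.
  move=> F FP Ftot; split=> [x y a [X FX Xx] [Y FY Yy]|x a [X FX Xx]].
    have [XY|YX] := Ftot X Y FX FY.
      by exists Y => //; have [YD _] := FP Y FY; apply: YD => //; apply: XY.
    by exists X => //; have [XD _] := FP X FX; apply: XD => //; apply: YX.
  by have [_] := FP X FX; apply.
pose N : set A := fun z => exists a x, (x = 0 \/ M x) /\ z = t * a + x.
have MN z : N z -> M z.
  apply: contrapT => nMN; apply: (Mmax N).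
    split=> [x Mx|NM]; last exact: nMN (NM _).
    by exists 0, x; split; [right | rewrite mulr0 add0r].
  split=> [_ _ c [a [x [Mx ->]]] [b [y [My ->]]]|_ c [a [x [Mx ->]]]].
    exists (a * c + b), (x * c + y); split; last by rewrite mulrDl mulrDr addrACA mulrA.
    case: Mx My => [->|Mx] [->|My].
    - by left; rewrite mul0r addr0.
    - by right; rewrite mul0r add0r.
    - right; have := MD _ _ (c - 1) Mx Mx.
      by rewrite mulrBr mulr1 subrK addr0.
    - by right; apply: MD.
  rewrite addrA -mulrDr; case: Mx => [->|]; last exact: M1.
  by rewrite addr0; apply: nt.
have M0 : M 0 by apply: MN; exists 0, 0; split; [left | rewrite mulr0 addr0].
have [m mM] := submodClosed_of_set M0 MD.
have tm : t \in m by apply/mM/MN; exists 1, 0; split; [left | rewrite mulr1 addr0].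
exists m => //; split.
  exists (1 : A); apply/negP => /mM M1'; apply: (M1 1 0 M1').
  by rewrite mulr0 add0r.
move=> m' mm' [x xm'] y ym'; apply/mM; apply: contrapT => nMy.
apply: (Mmax (fun z => z \in m')).
  split=> [z /mM/mm' //|m'M]; exact/nMy/m'M.
split=> [u v a um' vm'|u a um' E].
  by apply: (rpredD (V := (A^c)^o)) => //; apply: right_ideal_mulr.
suff m1 : (1 : A) \in m'.
  by have := right_ideal_mulr x m1; rewrite mul1r (negPf xm').
rewrite -E; apply: (rpredD (V := (A^c)^o)) => //.
exact/right_ideal_mulr/mm'.
Qed.

Lemma jacobsonP (x : A) :
  jacobson x <-> forall y, exists z, (1 - x * y) * z = 1.
Proof.
split=> [Jx y|inv m [[w wm] mmax]].
  apply: contrapT => ninv.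
  have [|m mmax tm] := @exists_maximal_right_ideal (1 - x * y).
    by move=> z zE; apply: ninv; exists z.
  have [[w wm] _] := mmax.
  have m1 : (1 : A) \in m.
    rewrite -(subrK (x * y) 1); apply: (rpredD (V := (A^c)^o)) => //.
    exact/right_ideal_mulr/Jx.
  by have := right_ideal_mulr w m1; rewrite mul1r (negPf wm).
apply: contrapT => xm.
pose M : set A := fun z => exists a b : A, a \in m /\ z = a + x * b.
have [||m' m'M] := @submodClosed_of_set M.
- by exists 0, 0; rewrite mulr0 addr0; split=> //; apply: rpred0.
- move=> _ _ c [a [b [am ->]]] [a' [b' [am' ->]]].
  exists (a * c + a'), (b * c + b'); split; last first.
    by rewrite mulrDl addrACA mulrDr mulrA.
  by apply: (rpredD (V := (A^c)^o)) => //; apply: right_ideal_mulr.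
have mm' : {subset m <= m'}.
  by move=> z zm; apply/m'M; exists z, 0; rewrite mulr0 addr0.
have xm' : x \in m'.
  by apply/m'M; exists 0, 1; rewrite mulr1 add0r; split=> //; apply: rpred0.
case: (pselect (exists z, z \notin m')) => [prop|nprop].
  exact/xm/(mmax m' mm').
have /m'M [a [b [am E]]] : (1 : A) \in m'.
  by apply: contrapT => /negP n1; apply: nprop; exists (1 : A).
have [z zE] := inv b.
have m1 : (1 : A) \in m by rewrite -zE {1}E addrK; apply: right_ideal_mulr.
by have := right_ideal_mulr w m1; rewrite mul1r (negPf wm).
Qed.

(** If w is a right inverse of 1 - x(ya), then 1 + awxy is one of 1 - (ax)y. *)
Lemma jacobsonMl a (x : A) : jacobson x -> jacobson (a * x).
Proof.
move=> /jacobsonP xJ; apply/jacobsonP => y; have [w wE] := xJ (y * a).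
exists (1 + a * w * x * y).
rewrite mulrDr mulr1.
have -> : (1 - a * x * y) * (a * w * x * y) = a * ((1 - x * (y * a)) * w) * x * y.
  by rewrite !mulrBl !mulrBr !mul1r !mulrBl !mulrA.
by rewrite wE mulr1 subrK.
Qed.

Lemma jacobsonMr (x : A) a : jacobson x -> jacobson (x * a).
Proof.
by move=> /jacobsonP xJ; apply/jacobsonP => y; rewrite -mulrA; apply: xJ.
Qed.

Lemma jacobson_inverse (x : A) : jacobson x ->
  exists w, (1 - x) * w = 1 /\ w * (1 - x) = 1.
Proof.
move=> xJ; have /jacobsonP /(_ 1) [w] := xJ; rewrite mulr1 => wE.
have /jacobsonP /(_ (- w)) [w' w'E] := xJ.
have wE' : w = 1 - x * - w.
  by rewrite mulrN opprK -{1}[w]mul1r -{1}(subrK x 1) mulrDl wE.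
rewrite -wE' in w'E; exists w; split=> //.
suff <- : w' = 1 - x by [].
have -> : w' = (1 - x) * w * w' by rewrite wE mul1r.
by rewrite -mulrA w'E mulr1.
Qed.

(** For H = AeA the product HJH vanishes iff eJe does, and eJe is the radical of eAe. An inverse z
    of e - (eye)b in the corner gives the right inverse 1 + bzy of 1 - by in A. *)
Lemma radical_vanishingP (H : ideal A) (e : A) : e * e = e ->
  (forall x, ideal_set H x <-> in_AeA e x) ->
  radical_vanishing H <-> semiprimitive_corner e.
Proof.
move=> ee HE.
have setmul1 (P Q : set A) x y : P x -> Q y -> setmul P Q (x * y).
  by move=> Px Qy; exists 1%N, (fun=> x), (fun=> y); rewrite big_ord1.
have -> : radical_vanishing H <-> forall j, jacobson j -> e * j * e = 0.
  have He : ideal_set H e by apply/HE/in_AeA_id.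
  split=> [rv j Jj|rv].
    have : setmul (setmul H (@jacobson A)) H (e * j * e) 
      by apply: (setmul1) => //; apply: (setmul1).
    by rewrite rv.
  apply/seteqP; split=> [x [m [p [q [pqP ->]]]]|x ->]; last first.
    by exists 0%N, (fun=> 0), (fun=> 0); split=> [[]|] //; rewrite big_ord0.
  apply: big1 => i _; have [[m' [p' [q' [pqP' ->]]]] /HE[J [a [b ->]]]] := pqP i.
  rewrite mulr_suml; apply: big1 => k _; have [/HE[J' [a' [b' ->]]] Jq] := pqP' k.
  rewrite mulr_sumr; apply: big1 => j _; rewrite !mulr_suml; apply: big1 => j' _.
  have -> : a' j' * e * b' j' * q' k * (a j * e * b j) =
    a' j' * (e * (b' j' * q' k * a j) * e) * b j by rewrite !mulrA.
  by rewrite rv ?mulr0 ?mul0r //; apply/jacobsonMr/jacobsonMl.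
split=> [rv b bP inv|sp j Jj].
  rewrite bP; apply: rv; apply/jacobsonP => y.
  have [z [zP _ zE]] := inv (e * y * e) (corner_mk y ee ee).
  have [eb be] := conj (corner_l ee bP) (corner_r ee bP).
  exists (1 + b * z * y); rewrite mulrDr mulr1 mulrBl mul1r.
  have -> : b * y * (b * z * y) = b * ((e * y * e * b) * z) * y.
    by rewrite !mulrA be -(mulrA (b * y) e) eb.
  have -> : b * z * y - b * (e * y * e * b * z) * y = b * ((e - e * y * e * b) * z) * y.
    by rewrite mulrBl (corner_l ee zP) mulrBr mulrBl.
  by rewrite zE be subrK.
apply: sp; first exact: corner_mk.
move=> y yP; have [w [w1 w2]] : exists w, (1 - y * j * e) * w = 1 /\ w * (1 - y * j * e) = 1.
  exact/jacobson_inverse/jacobsonMr/jacobsonMl.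
have E1 : e * (1 - y * j * e) = e - y * (e * j * e).
  by rewrite mulrBr mulr1 !mulrA (corner_l ee yP) (corner_r ee yP).
have E2 : (1 - y * j * e) * e = e - y * (e * j * e).
  by rewrite mulrBl mul1r -(mulrA _ e e) ee !mulrA (corner_r ee yP).
exists (e * w * e); split; first exact: corner_mk.
  by rewrite -E1 -(mulrA (e * w)) (mulrA e e) ee E1 -E2 -!(mulrA e) (mulrA w) w2 mul1r.
move: (1 - y * j * e) w1 w2 E1 E2 => q w1 w2 E1 E2.
rewrite -E2 -!mulrA (mulrA e e) ee (mulrA q e (w * e)) E2 -E1.
by rewrite -!mulrA (mulrA q w) w1 mul1r.
Qed.

End Jacobson.

Lemma in_AeA_converse (A : pzRingType) (g x : A) : @in_AeA A^c g x <-> in_AeA g x.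
Proof.
by split=> -[J [a [b ->]]]; exists J, b, a; apply: eq_bigr => j _;
  rewrite ?mulcE mulrA.
Qed.

(** The same s works for every g: scalars of R are central and move across g into the left
    coefficient. *)
Lemma artin_generators (A : pzRingType) : artin_algebra A ->
  exists (m : nat) (s : 'I_m -> A), forall g x, in_AeA g x ->
    exists a : 'I_m -> A, x = \sum_k a k * (g * s k).
Proof.
move=> [R [phi [_ phiC [m [s gen]]]]]; exists m, s => g x [J [a [b ->]]].
have /choice [c cE] j := gen (b j).
exists (fun k => \sum_j a j * phi (c j k)).
under [RHS]eq_bigr => k _ do rewrite mulr_suml.
rewrite exchange_big; apply: eq_bigr => j _ /=.
rewrite {1}cE mulr_sumr; apply: eq_bigr => k _.
by rewrite -!mulrA; congr (_ * _); rewrite !mulrA -phiC.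
Qed.

Section IdealModules.
Variables (A : pzRingType) (hA : artin_algebra A) (H : ideal A) (g : A).
Hypotheses (gg : g * g = g) (HE : forall x, ideal_set H x <-> in_AeA g x).

Lemma left_module_projectiveP :
  projective (left_module H) <-> @dual_basis A^c 1 g 1.
Proof.
rewrite -left_dual_basisE; have [m [s gen]] := artin_generators hA.
apply: (@ideal_projectiveP A (@left_pred A H) g m s gg _ (gen g)) => x.
by rewrite -HE; split=> /asboolP.
Qed.

Lemma right_module_projectiveP :
  projective (right_module H) <-> dual_basis 1 g 1.
Proof.
rewrite -left_dual_basisE_conv.
have [m [s gen]] := artin_generators (artin_converse hA).
apply: (@ideal_projectiveP A^c (@right_pred A H) g m s gg _ (gen g)) => x.
by rewrite in_AeA_converse -HE; split=> /asboolP.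
Qed.

End IdealModules.

(** * The quotient rings of the chain *)

Section QuotRing.
Variables (A : pzRingType) (I : ideal A) (g : A).
Hypothesis IE : forall x, ideal_set I x <-> in_AeA g x.

Lemma quot_pi_quotient_map : quotient_map (@quot_pi A I) g.
Proof.
split=> //; first exact: quot_piD.
- by move=> x y; rewrite -quot_mulE.
- by move=> y; exists (quot_repr y); apply: quot_reprK.
- move=> x; rewrite -IE -{2}[x]subr0 -quot_piP.
  by rewrite (_ : quot_pi I 0 = 0) //; apply: raddf0.
Qed.

Lemma quot_artin : artin_algebra A -> artin_algebra (quot_ring I).
Proof.
move=> [R [phi [hR phiC [m [s gen]]]]].
have [piD piM pi1 piS _] := quot_pi_quotient_map.
pose psi : R -> quot_ring I := fun r => quot_pi I (phi r).
have psiA : zmod_morphism psi.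
  by move=> x y; rewrite /psi rmorphB (quotient_mapB quot_pi_quotient_map).
have psiM : monoid_morphism psi.
  by split=> [|x y]; rewrite /psi ?rmorph1 // rmorphM piM.
pose psi' : {rmorphism R -> quot_ring I} := HB.pack_for {rmorphism R -> quot_ring I} psi
  (GRing.isZmodMorphism.Build _ _ psi psiA) (GRing.isMonoidMorphism.Build _ _ psi psiM).
exists R, psi'; split=> //.
  by move=> r a; have [x <-] := piS a; rewrite /= /psi -!piM phiC.
exists m, (fun i => quot_pi I (s i)) => a; have [x <-] := piS a.
have [c ->] := gen x; exists c; rewrite (quotient_map_sum quot_pi_quotient_map).
by apply: eq_bigr => i _; rewrite piM.
Qed.

Lemma quot_idealE (H : ideal A) f : (forall x, ideal_set H x <-> in_AeA f x) ->
  forall y, ideal_set (quot_ideal I H) y <-> in_AeA (quot_pi I f) y.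
Proof.
move=> HE y; have [piD piM pi1 piS _] := quot_pi_quotient_map.
split=> [[x /HE [J [a [b ->]]] <-]|[J [a [b ->]]]].
  exists J, (quot_pi I \o a), (quot_pi I \o b).
  rewrite (quotient_map_sum quot_pi_quotient_map).
  by apply: eq_bigr => j _; rewrite !piM.
have /choice [s sK] := piS.
exists (\sum_j s (a j) * f * s (b j)); first by apply/HE; exists J, (s \o a), (s \o b).
rewrite (quotient_map_sum quot_pi_quotient_map).
by apply: eq_bigr => j _; rewrite !piM !sK.
Qed.

End QuotRing.

Lemma quotient_map_converse (A B : pzRingType) (p : A -> B) (g : A) :
  quotient_map p g -> @quotient_map A^c B^c p g.
Proof.
move=> [pD pM p1 pS ker]; split=> //; first by move=> x y; apply: pM.
by move=> x; rewrite in_AeA_converse; apply: ker.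
Qed.

Lemma heredity_symmetric (B : pzRingType) (e : B) : artin_algebra B -> e * e = e ->
  semiprimitive_corner e -> dual_basis 1 e 1 <-> @dual_basis B^c 1 e 1.
Proof.
move=> hB ee sp; rewrite -left_dual_basisE; split.
  have [R [phi [hR phiC [m [s gen]]]]] := hB.
  exact: (semisimple_left_dual_basis ee sp hR phiC gen).
have [R [phi [hR phiC [m [s gen]]]]] := artin_converse hB.
rewrite left_dual_basisE -(@left_dual_basisE_conv B e).
apply: (semisimple_left_dual_basis _ _ hR phiC gen) => //.
exact: semiprimitive_corner_converse.
Qed.

(** * Reflections and coreflections in additive categories *)

Section PreCatSums.
Variable C : precat.

Lemma comp_suml (X Y Z : C) (I : finType) (F : I -> mor Y Z) (h : mor X Y) :
  (\sum_k F k) \oc h = \sum_k (F k \oc h).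
Proof.
exact: (big_morph (fun g => g \oc h) (fun g g' => compDl g g' h) (comp0m Z h)).
Qed.

Lemma comp_sumr (X Y Z : C) (I : finType) (F : I -> mor X Y) (h : mor Y Z) :
  h \oc (\sum_k F k) = \sum_k (h \oc F k).
Proof.
exact: (big_morph (fun g => h \oc g) (fun g g' => compDr h g g') (compm0 X h)).
Qed.

(* Equivalently, X is a direct summand of a finite power of M. *)
Definition power_retract (M X : C) : Prop :=
  exists (I : finType) (a : I -> mor M X) (b : I -> mor X M),
    \sum_t a t \oc b t = idm X.

Definition split_idempotents : Prop :=
  forall (X : C) (p : mor X X), p \oc p = p ->
    exists (Y : C) (i : mor Y X) (q : mor X Y), q \oc i = idm Y /\ i \oc q = p.

(** The counterpart of [lin_on], with relations tested on maps out of W. *)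
Definition mor_lin (M N W : C) (c : mor M N -> mor M M) : Prop :=
  forall (J : finType) (x : J -> mor M N) (b : J -> mor W M),
    \sum_j x j \oc b j = 0 -> \sum_j c (x j) \oc b j = 0.

Definition mor_dual_basis (M N W : C) : Prop :=
  exists (I : finType) (u : I -> mor M N) (c : I -> mor M N -> mor M M),
    (forall x, x = \sum_k u k \oc c k x) /\ (forall k, mor_lin W (c k)).

Definition factors_sum (M X Y : C) (f : mor X Y) : Prop :=
  exists (I : finType) (a : I -> mor M Y) (b : I -> mor X M),
    f = \sum_t a t \oc b t.

Lemma power_retract_refl M : power_retract M M.
Proof.
exists unit, (fun=> idm M), (fun=> idm M).
by rewrite big_const card_unit /= addr0 comp1m.
Qed.

Lemma power_retract_trans M X Y :
  power_retract M X -> power_retract X Y -> power_retract M Y.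
Proof.
move=> [I [a [b ab]]] [J [c [d cd]]].
exists (J * I)%type, (fun z => c z.1 \oc a z.2), (fun z => b z.2 \oc d z.1).
rewrite -(pair_bigA _ (fun j i => c j \oc a i \oc (b i \oc d j))) /= -[RHS]cd.
apply: eq_bigr => j _; under eq_bigr => i _ do rewrite compA -(compA (c j)).
by rewrite -comp_suml -comp_sumr ab compm1.
Qed.

Lemma mor_lin_retract (M N W Z : C) (c : mor M N -> mor M M) :
  power_retract W Z -> mor_lin W c -> mor_lin Z c.
Proof.
move=> [T [a [b ab]]] lc J x d xd0.
rewrite -[LHS]compm1 -ab comp_sumr big1 // => t _; rewrite compA comp_suml.
under eq_bigr => j _ do rewrite -compA.
rewrite lc ?comp0m //; under eq_bigr => j _ do rewrite compA.
by rewrite -comp_suml xd0 comp0m.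
Qed.

Lemma mor_dual_basis_retract (M N X W : C) : power_retract N X ->
  mor_dual_basis M N W -> mor_dual_basis M X W.
Proof.
move=> [T [a [b ab]]] [I [u [c [uc lc]]]].
exists (T * I)%type, (fun z => a z.1 \oc u z.2), (fun z x => c z.2 (b z.1 \oc x)).
split=> [x|z J x d xd0].
  rewrite -(pair_bigA _ (fun t k => a t \oc u k \oc c k (b t \oc x))) /=.
  rewrite -{1}[x]comp1m -ab comp_suml; apply: eq_bigr => t _.
  rewrite -compA {1}[b t \oc x]uc comp_sumr; apply: eq_bigr => k _.
  by rewrite compA.
apply: lc; under eq_bigr => j _ do rewrite -compA.
by rewrite -comp_sumr xd0 compm0.
Qed.

Lemma catideal_sum (I : catideal C) (X Y : C) (T : finType) (F : T -> mor X Y) :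
  (forall t, in_catideal I (F t)) -> in_catideal I (\sum_t F t).
Proof.
move=> IF; elim/big_ind: _ => // [|x y Ix Iy]; first exact: catideal0.
rewrite -[y]opprK; apply: catidealB => //; rewrite -sub0r.
exact: catidealB (catideal0 _ _ _) Iy.
Qed.

Lemma isom_swap (X Y : C) (g : mor Y X) (f : mor X Y) :
  isom (idm X - g \oc f) -> isom (idm Y - f \oc g).
Proof.
move=> [z [zl zr]]; exists (idm Y + f \oc z \oc g).
have zl' : z \oc g \oc f = z - idm X.
  by rewrite -[X in z - X]zl compBr compm1 opprB addrC subrK compA.
have zr' : g \oc f \oc z = z - idm X.
  by rewrite -[X in z - X]zr compBl comp1m opprB addrC subrK.
split.
  rewrite compDl !compBr !compm1 comp1m.
  have -> : f \oc z \oc g \oc (f \oc g) = f \oc (z \oc g \oc f) \oc g by rewrite !compA.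
  by rewrite zl' compBr compm1 compBl opprB [X in _ + X]addrC !subrK.
rewrite compDr !compBl !compm1 !comp1m.
have -> : f \oc g \oc (f \oc z \oc g) = f \oc (g \oc f \oc z) \oc g by rewrite !compA.
by rewrite zr' compBr compm1 compBl opprB [X in _ + X]addrC !subrK.
Qed.

End PreCatSums.

Section Power.
Variable C : addcat.

Lemma ord_power_exists (M : C) m : exists (P : C) (i : 'I_m -> mor M P) (p : 'I_m -> mor P M),
  (forall k l, p k \oc i l = if k == l then idm M else 0) /\
  \sum_k i k \oc p k = idm P.
Proof.
elim: m => [|m [P [i [p [pi ip]]]]].
  have [Z Z0] := has_zero_obj C; exists Z, (fun=> 0), (fun=> 0).
  by split=> [[]//|]; rewrite big_ord0; apply/esym/(proj1 (Z0 Z)).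
have [Q [i1 [i2 [p1 [p2 [e11 e22 e21 e12 e]]]]]] := has_direct_sum M P.
exists Q, (fun k => if unlift ord0 k is Some k' then i2 \oc i k' else i1).
exists (fun k => if unlift ord0 k is Some k' then p k' \oc p2 else p1).
split=> [k l|]; last first.
  rewrite big_ord_recl unlift_none -[RHS]e; congr (_ + _).
  under eq_bigr => k _ do rewrite liftK compA -(compA i2).
  by rewrite -comp_suml -comp_sumr ip compm1.
case: unliftP => [k'|] ->; case: unliftP => [l'|] ->.
- rewrite (inj_eq lift_inj) -pi compA -(compA (p k')) e22.
  by rewrite compm1.
- by rewrite -compA e21 compm0 eq_sym (negPf (neq_lift _ _)).
- by rewrite compA e12 comp0m (negPf (neq_lift _ _)).
- by rewrite eqxx.
Qed.

Lemma power_exists (M : C) (I : finType) :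
  exists (P : C) (i : I -> mor M P) (p : I -> mor P M),
  (forall k l, p k \oc i l = if k == l then idm M else 0) /\
  \sum_k i k \oc p k = idm P.
Proof.
have [P [i [p [pi ip]]]] := ord_power_exists M #|I|.
exists P, (i \o enum_rank), (p \o enum_rank); split=> [k l|] /=.
  by rewrite pi (inj_eq enum_rank_inj).
by rewrite -ip [RHS](reindex _ (onW_bij _ (enum_rank_bij I))).
Qed.

(** A retract of Z, with s and r, is a direct summand once the complementary idempotent id - sr
    splits. *)
Lemma in_addP (M X : C) : split_idempotents C -> in_add M X <-> power_retract M X.
Proof.
move=> spl; split=> [[m [Z [[i [p [_ _ ip]]] [Y [j1 [_ [q1 [_ [qj _ _ _ _]]]]]]]]]|].
  exists 'I_m, (fun k => q1 \oc i k), (fun k => p k \oc j1).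
  under eq_bigr => k _ do rewrite compA -(compA q1).
  by rewrite -comp_suml -comp_sumr ip compm1.
move=> [I [a [b ab]]].
have [Z [i [p [pi ip]]]] := ord_power_exists M #|I|.
exists #|I|, Z; split.
  exists i, p; split=> // [k|k l kl]; first by rewrite pi eqxx.
  by rewrite pi eq_sym (negPf kl).
pose s := \sum_k i k \oc b (enum_val k).
pose r := \sum_k a (enum_val k) \oc p k.
have rs : r \oc s = idm X.
  rewrite /r /s comp_suml -ab (reindex _ (onW_bij _ (enum_val_bij I))) /=.
  apply: eq_bigr => k _; rewrite comp_sumr (bigD1 k) //= big1 => [|l lk].
    by rewrite addr0 compA -(compA (a _)) pi eqxx compm1.
  by rewrite compA -(compA (a _)) pi eq_sym (negPf lk) compm0 comp0m.
have idem : (idm Z - s \oc r) \oc (idm Z - s \oc r) = idm Z - s \oc r.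
  rewrite compBl !compBr !compm1 comp1m.
  by rewrite -compA (compA r) rs comp1m subrr subr0.
have [Y [j [q [qj jq]]]] := spl Z _ idem.
have qE : q = q \oc (idm Z - s \oc r) by rewrite -jq compA qj comp1m.
have jE : j = (idm Z - s \oc r) \oc j by rewrite -jq -compA qj compm1.
exists Y, s, j, r, q; split=> //.
- by rewrite qE -compA compBl comp1m -compA rs compm1 subrr compm0.
- by rewrite jE compA compBr compm1 compA rs comp1m subrr comp0m.
- by rewrite jq addrC subrK.
Qed.

Lemma split_idempotents_full (S : subcat C) :
  split_idempotents C -> split_idempotents (full S).
Proof.
move=> spl X p pp0; have pp : @mcomp C (sval X) (sval X) (sval X) p p = p := pp0.
have [Y [i [q [qi iq]]]] := spl (sval X) p pp.
have pp' : (idm (sval X) - p) \oc (idm (sval X) - p) = idm (sval X) - p.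
  by rewrite compBl !compBr !compm1 !comp1m pp subrr subr0.
have [Y' [i' [q' [qi' iq']]]] := spl (sval X) _ pp'.
have SY : S Y.
  apply: (@subcat_summand _ _ _ (sval X)); last exact: svalP.
  have qE : q' = q' \oc (idm (sval X) - p) by rewrite -iq' compA qi' comp1m.
  have iE : i' = (idm (sval X) - p) \oc i' by rewrite -iq' -compA qi' compm1.
  exists Y', i, i', q, q'; split=> //.
  - by rewrite qE -compA compBl comp1m -iq -compA qi compm1 subrr compm0.
  - by rewrite iE compA compBr compm1 -iq compA qi comp1m subrr comp0m.
  - by rewrite iq iq' addrC subrK.
by exists (exist _ Y SY), i, q.
Qed.

End Power.

Section Coreflections.
Variables (C : addcat) (S : subcat C) (M N : C).
Hypotheses (spl : split_idempotents C) (SM : forall X, S X <-> power_retract M X).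
Hypothesis NC : forall X, power_retract N X.

(** The categorical form of [inY] and [eps]: Y is the image of the idempotent matrix (c_k(u_l)) on a
    power of M, and the u_k induce the arrow. The test object W decides against which maps it is
    cancellable. *)
Lemma universal_arrow (W X : C) : power_retract W M -> mor_dual_basis M X W ->
  exists (Y : C) (eps : mor Y X),
    [/\ S Y, forall Z (f : mor Z X), S Z -> exists h, eps \oc h = f
      & forall Z (h h' : mor Z Y), power_retract W Z ->
          eps \oc h = eps \oc h' -> h = h'].
Proof.
move=> WM [I [u [c [uc lc]]]].
have [P [i [p [pi ip]]]] := power_exists M I.
have pi_sum k (F : I -> mor M M) : p k \oc (\sum_l i l \oc F l) = F k.
  rewrite comp_sumr (bigD1 k) //= big1 => [|l lk].
    by rewrite addr0 compA pi eqxx comp1m.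
  by rewrite compA pi eq_sym (negPf lk) comp0m.
pose w := \sum_k u k \oc p k.
pose l x := \sum_k i k \oc c k x.
have wl x : w \oc l x = x.
  rewrite [RHS]uc comp_suml; apply: eq_bigr => k _.
  by rewrite -compA pi_sum.
pose E := \sum_k l (u k) \oc p k.
(* [mor_lin] applied to the relation x - sum u_j c_j(x) = 0, with x as the extra index [inl]. *)
have lin k x : c k x = \sum_j c k (u j) \oc c j x.
  have := mor_lin_retract WM (lc k) (J := (unit + I)%type)
    (x := fun j => if j is inr j then u j else x)
    (b := fun j => if j is inr j then - c j x else idm M).
  rewrite !big_sumType !(big_const, card_unit) /= !addr0 !compm1.
  have EN U (F : I -> mor M U) : \sum_j F j \oc - c j x = - \sum_j F j \oc c j x.
    by rewrite -sumrN; apply: eq_bigr => j _; rewrite compmN.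
  by rewrite !EN -uc subrr => /(_ erefl) /eqP; rewrite subr_eq0 => /eqP.
have El x : E \oc l x = l x.
  rewrite comp_suml; under eq_bigr => k _ do rewrite -compA pi_sum comp_suml.
  rewrite exchange_big; apply: eq_bigr => k _ /=; rewrite [in RHS]lin comp_sumr.
  by apply: eq_bigr => j _; rewrite compA.
have EE : E \oc E = E.
  by rewrite {2}/E comp_sumr; apply: eq_bigr => k _; rewrite compA El.
have wE : w \oc E = w.
  by rewrite comp_sumr; apply: eq_bigr => k _; rewrite compA wl.
have [Y [j [q [qj jq]]]] := spl EE.
exists Y, (w \oc j); split.
- apply/SM; exists I, (fun k => q \oc i k), (fun k => p k \oc j).
  under eq_bigr => k _ do rewrite compA -(compA q).
  by rewrite -comp_suml -comp_sumr ip compm1.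
- move=> Z f /SM [T [a [b ab]]].
  exists (\sum_t q \oc l (f \oc a t) \oc b t).
  rewrite comp_sumr -[RHS]compm1 -ab comp_sumr; apply: eq_bigr => t _.
  by rewrite !compA -(compA w) jq wE wl.
move=> Z h h' WZ hh'; apply/eqP; rewrite -subr_eq0; apply/eqP.
have {hh'} : w \oc j \oc (h - h') = 0 by rewrite compBr hh' subrr.
move: (h - h') => {h'}h wjh.
have Ejh : E \oc (j \oc h) = 0.
  rewrite comp_suml; under eq_bigr => k _ do rewrite -compA comp_suml.
  rewrite exchange_big big1 // => k _ /=; under eq_bigr => m _ do rewrite -compA.
  rewrite -comp_sumr (mor_lin_retract WZ (lc k)) ?compm0 //.
  rewrite -[RHS]wjh -compA comp_suml.
  by apply: eq_bigr => m _; rewrite -compA.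
rewrite -[h]comp1m -qj -compA -[j]compm1 -qj (compA j) jq -compA Ejh compm0 //.
Qed.

Definition couniversal (X Y : C) (eps : mor Y X) : Prop :=
  [/\ S Y, forall Z (f : mor Z X), S Z -> exists h, eps \oc h = f
    & forall Z (h h' : mor Z Y), S Z -> eps \oc h = eps \oc h' -> h = h'].

Lemma adj_counit_couniversal (G : functor C (full S))
    (a : adjunction (inclusion S) G) (X : C) : couniversal (adj_counit a X).
Proof.
split=> [|Z f SZ|Z h h' SZ E]; first exact: (svalP (G X)).
  pose Z' : full S := exist _ Z SZ.
  exists (fmap G (f : mor (inclusion S Z') X) \oc adj_unit a Z').
  have := counit_nat a (f : mor (inclusion S Z') X) => nat.
  have tri : adj_counit a (inclusion S Z') \oc adj_unit a Z' = idm Z := adj_triangleL a Z'.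
  by rewrite compA -[X in X \oc _]nat -compA tri compm1.
pose Z' : full S := exist _ Z SZ.
have key (k : mor Z' (G X)) :
    k = fmap G (adj_counit a X \oc fmap (inclusion S) k) \oc adj_unit a Z'.
  by rewrite fmapM -compA unit_nat compA adj_triangleR comp1m.
have E' : adj_counit a X \oc fmap (inclusion S) (h : mor Z' (G X)) =
          adj_counit a X \oc fmap (inclusion S) (h' : mor Z' (G X)) := E.
apply: etrans (key h) (etrans _ (esym (key h'))).
by rewrite E'.
Qed.

(** R carries a further property of the chosen arrows over to the counit: nothing for coreflections,
    monicity for right rejections. *)
Lemma couniversal_adjunction (R : forall X Y : C, mor Y X -> Prop) :
  (forall X, exists (Y : C) (eps : mor Y X), couniversal eps /\ R X Y eps) ->
  exists (G : functor C (full S)) (a : adjunction (inclusion S) G),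
    forall X, R X _ (adj_counit a X).
Proof.
move=> H.
have {}H X : exists z : {Y : C & mor Y X}, couniversal (projT2 z) /\ R _ _ (projT2 z).
  by have [Y [eps P]] := H X; exists (existT _ Y eps).
pose F X := cid (H X).
pose Y X := projT1 (sval (F X)); pose eps X : mor (Y X) X := projT2 (sval (F X)).
have FP X : couniversal (eps X) /\ R _ _ (eps X) := svalP (F X).
have SY X : S (Y X) by have [[]] := FP X.
have lift_ex X Z (f : mor Z X) (SZ : S Z) : exists h, eps X \oc h = f.
  by have [[_ + _] _] := FP X; apply.
pose lft X Z f SZ := sval (cid (@lift_ex X Z f SZ)).
have lftE X Z f SZ : eps X \oc @lft X Z f SZ = f := svalP (cid (@lift_ex X Z f SZ)).
have inj X Z (h h' : mor Z (Y X)) : S Z -> eps X \oc h = eps X \oc h' -> h = h'.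
  by have [[_ _ +] _] := FP X; apply.
pose Gm X X' (f : mor X X') : mor (Y X) (Y X') := lft X' _ (f \oc eps X) (SY X).
have GmE X X' (f : mor X X') : eps X' \oc Gm X X' f = f \oc eps X by apply: lftE.
have Gm1 X : Gm X X (idm X) = idm (Y X).
  by apply: inj => //; rewrite GmE comp1m compm1.
have GmM X X' X'' (g : mor X' X'') (f : mor X X') :
    Gm _ _ (g \oc f) = Gm _ _ g \oc Gm _ _ f.
  by apply: inj => //; rewrite GmE [RHS]compA GmE -[RHS]compA GmE [RHS]compA.
pose G : functor C (full S) :=
  @Functor C (full S) (fun X => exist _ (Y X) (SY X)) Gm Gm1 GmM.
pose eta (X : full S) : mor X (G (inclusion S X)) :=
  lft (sval X) (sval X) (idm (sval X)) (svalP X).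
have etaE (X : full S) : eps (sval X) \oc eta X = idm (sval X) by apply: lftE.
have unat (X X' : full S) (f : mor X X') :
    fmap G (fmap (inclusion S) f) \oc eta X = eta X' \oc f.
  apply: (inj (sval X')); first exact: svalP.
  rewrite [LHS]compA [X in X \oc _]GmE -[LHS]compA etaE compm1.
  by rewrite [RHS](compA (eps _)) etaE comp1m.
have cnat X X' (f : mor X X') :
    f \oc eps X = eps X' \oc fmap (inclusion S) (fmap G f) by rewrite GmE.
have triL (X : full S) :
    eps (inclusion S X) \oc fmap (inclusion S) (eta X) = idm (inclusion S X).
  exact: etaE.
have triR X : fmap G (eps X) \oc eta (G X) = idm (G X).
  apply: (inj X (Y X) (Gm _ _ (eps X) \oc (eta (G X) : mor (Y X) (Y (Y X))))) => //.
  have E : eps (Y X) \oc eta (G X) = idm (Y X) := etaE (G X).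
  by rewrite compA GmE -compA E.
exists G, (@Adjunction (full S) C (inclusion S) G eta eps unat cnat triL triR) => X.
by have [] := FP X.
Qed.

(** If a, b present Y as a retract of a power of M and h lifts maps along eps, the generators are
    eps a_k and the coordinates x |-> b_k h(x). Cancellability of eps on W makes h compatible with
    relations. *)
Lemma couniversal_dual_basis (W Y : C) (eps : mor Y N) : S M ->
  couniversal eps ->
  (forall h h' : mor W Y, eps \oc h = eps \oc h' -> h = h') ->
  mor_dual_basis M N W.
Proof.
move=> SM' [/SM [I [a [b ab]]] ex _] inj.
have /choice [h hE] x := ex M x SM'.
exists I, (fun k => eps \oc a k), (fun k x => b k \oc h x).
split=> [x|k J x d xd0].
  under eq_bigr => k _ do rewrite compA -(compA eps).
  by rewrite -comp_suml -comp_sumr ab compm1 hE.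
under eq_bigr => j _ do rewrite -compA.
rewrite -comp_sumr (inj (\sum_j h (x j) \oc d j) 0) ?compm0 //.
rewrite comp_sumr -[RHS]xd0; apply: eq_bigr => j _.
by rewrite compA hE.
Qed.

Let SMM : S M. Proof. exact/SM/power_retract_refl. Qed.

(** Since every object is a retract of a power of N, a basis at N yields one at each X. Here the
    arrow is tested on S; in [right_rejectiveP] the test object N reaches all of C. *)
Lemma coreflectiveP : coreflective S <-> mor_dual_basis M N M.
Proof.
split=> [[G [a]]|db].
  have cu := adj_counit_couniversal a N; apply: (couniversal_dual_basis SMM cu).
  by move=> h h'; have [_ _] := cu; apply.
have [|G [a _]] := @couniversal_adjunction (fun _ _ _ => True).
  move=> X; have db' := mor_dual_basis_retract (NC X) db.
  have [Y [eps [SY ex inj]]] := universal_arrow (power_retract_refl M) db'.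
  exists Y, eps; split=> //; split=> // Z h h' /SM; exact: inj.
by exists G; split.
Qed.

Lemma right_rejectiveP : right_rejective S <-> mor_dual_basis M N N.
Proof.
split=> [[G [a am]]|db].
  apply: (couniversal_dual_basis SMM (adj_counit_couniversal a N)) => h h'.
  exact: am.
apply: (@couniversal_adjunction (fun X Y eps => monom eps)) => X.
have db' := mor_dual_basis_retract (NC X) db.
have [Y [eps [SY ex inj]]] := universal_arrow (NC M) db'.
exists Y, eps; split; last by move=> Z h h'; apply: inj.
by split=> // Z h h' _; apply: inj.
Qed.

Lemma subcat_idealP X Y (f : mor X Y) :
  in_catideal (subcat_ideal S) f <-> factors_sum M f.
Proof.
split=> [[Z [/SM [I [a [b ab]]] [g [h ->]]]]|[I [a [b ->]]]].
  exists I, (fun k => g \oc a k), (fun k => b k \oc h).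
  under eq_bigr => k _ do rewrite compA -(compA g).
  by rewrite -comp_suml -comp_sumr ab compm1.
by apply: catideal_sum => k; exists M; split=> //; exists (a k), (b k).
Qed.

Lemma cosemisimpleP : cosemisimple S <->
  forall b : mor N N,
    (forall y : mor N N, exists z, factors_sum M (z \oc (idm N - y \oc b) - idm N) /\
       factors_sum M ((idm N - y \oc b) \oc z - idm N)) ->
    factors_sum M b.
Proof.
pose I := subcat_ideal S; pose pi (X Y : C) (f : mor X Y) := factor_pi I f.
have piS (X Y : C) (f : factor_hom I X Y) : exists g, f = pi X Y g.
  by exists (factor_repr f); rewrite /pi factor_reprK.
have piP (X Y : C) (f g : mor X Y) : pi X Y f = pi X Y g <-> factors_sum M (f - g).
  by rewrite -subcat_idealP; apply: factor_piP.
have piM (X Y Z : C) (g : mor Y Z) (f : mor X Y) :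
    @mcomp (factor_cat I) X Y Z (pi _ _ g) (pi _ _ f) = pi _ _ (g \oc f).
  exact: factor_compE.
have piB (X Y : C) (f g : mor X Y) :
    pi X Y (f - g) = (pi X Y f : @mor (factor_cat I) X Y) - pi X Y g.
  apply: (addIr (pi X Y g)); rewrite subrK.
  by rewrite -[LHS]factor_piD subrK.
have pi0 (X Y : C) : pi X Y 0 = 0 :> @mor (factor_cat I) X Y.
  by apply: (addIr (pi X Y 0)); rewrite -[LHS]factor_piD !add0r.
have pi0P (X Y : C) (f : mor X Y) :
    pi X Y f = 0 :> @mor (factor_cat I) X Y <-> factors_sum M f.
  by have := piP X Y f 0; rewrite subr0 pi0.
have isoP (X : C) (f : mor X X) : @isom (factor_cat I) X X (pi X X f) <->
    exists z, factors_sum M (z \oc f - idm X) /\ factors_sum M (f \oc z - idm X).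
  split=> [[g [gf fg]]|[z [/piP zf /piP fz]]].
    by have [z zE] := piS _ _ g; exists z; rewrite -!piP -!piM -zE.
  by exists (pi X X z); rewrite !piM.
have jacE (X Y : C) (f : mor X Y) (g : mor Y X) :
    @idm (factor_cat I) X - @mcomp (factor_cat I) X Y X (pi Y X g) (pi X Y f) =
    pi X X (idm X - g \oc f).
  by rewrite piM piB.
split=> [cs b bP|cs X Y f' fJ].
  apply/pi0P/cs => g'; have [g ->] := piS _ _ g'.
  by rewrite jacE; apply/isoP.
have [f fE] := piS _ _ f'; rewrite {}fE in fJ *; apply/pi0P.
have [T [a [b ab]]] := NC X; have [T' [a' [b' ab']]] := NC Y.
suff comp t t' : factors_sum M (b' t' \oc f \oc a t).
  have -> : f = \sum_t' \sum_t a' t' \oc (b' t' \oc f \oc a t) \oc b t.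
    rewrite -{1}[f]comp1m -ab' comp_suml; apply: eq_bigr => t' _.
    rewrite -{1}[f]compm1 -ab !comp_sumr; apply: eq_bigr => t _.
    by rewrite !compA.
  apply/subcat_idealP; apply: catideal_sum => t'; apply: catideal_sum => t.
  by apply/catidealMr/catidealMl/subcat_idealP.
apply: cs => y; apply/isoP.
have -> : idm N - y \oc (b' t' \oc f \oc a t) = idm N - (y \oc b' t' \oc f) \oc a t.
  by rewrite !compA.
(* The swap replaces the endomorphism of N by id - (a y b') f on X, to which the assumption on f
   applies. *)
rewrite -jacE; apply: isom_swap; rewrite jacE.
have := fJ (pi _ _ (a t \oc y \oc b' t')); rewrite jacE.
by rewrite !compA.
Qed.

End Coreflections.

(** * Reflections as coreflections in the opposite category *)

Definition op (C : precat) : precat :=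
  @PreCat C (fun X Y => mor Y X) (fun X => idm X) (fun X Y Z g f => f \oc g)
    (fun X Y f => compm1 f) (fun X Y f => comp1m f)
    (fun X Y Z W h g f => esym (compA f g h))
    (fun X Y Z g g' f => compDr f g g') (fun X Y Z g f f' => compDl f f' g).

Section Opposite.
Variable C : addcat.

Lemma op_has_zero_obj : exists Z : op C, zero_obj Z.
Proof.
have [Z Z0] := has_zero_obj C; exists Z => X.
by have [? ?] := Z0 X.
Qed.

Lemma op_direct_sum (X Y Z : C) : @direct_sum C X Y Z <-> @direct_sum (op C) X Y Z.
Proof.
by split=> -[i1 [i2 [p1 [p2 [e11 e22 e21 e12 e]]]]]; exists p1, p2, i1, i2.
Qed.

Lemma op_has_direct_sum (X Y : op C) : exists Z, direct_sum X Y Z.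
Proof.
by have [Z /op_direct_sum XYZ] := has_direct_sum (X : C) (Y : C); exists Z.
Qed.

Definition opadd : addcat := AddCat op_has_zero_obj op_has_direct_sum.

Definition opsub (S : subcat C) : subcat opadd.
Proof.
apply: (@SubCat opadd (fun X => S X)).
- move=> Z Z0; apply: subcat_zero => X; by have [? ?] := Z0 X.
- move=> X Y f [g [gf fg]]; apply: (@subcat_iso C S X Y g).
  by exists f.
- by move=> X Y Z /op_direct_sum; apply: subcat_sum.
- move=> X Z [Y /op_direct_sum XYZ]; apply: (@subcat_summand C S X Z).
  by exists Y.
Defined.

Lemma op_split_idempotents : split_idempotents C -> split_idempotents opadd.
Proof. by move=> spl X p pp; have [Y [i [q [qi iq]]]] := spl X p pp; exists Y, q, i. Qed.

Lemma op_power_retract (M X : C) :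
  @power_retract C M X <-> @power_retract opadd M X.
Proof. by split=> -[I [a [b ab]]]; exists I, b, a. Qed.

Variable S : subcat C.

Definition functor_to_op (G : functor C (full S)) : functor opadd (full (opsub S)) :=
  @Functor opadd (full (opsub S)) (fun X => G X) (fun X Y f => @fmap _ _ G Y X f)
    (fun X => fmap1 G X) (fun X Y Z g f => @fmapM _ _ G Z Y X f g).

Definition functor_of_op (G : functor opadd (full (opsub S))) : functor C (full S) :=
  @Functor C (full S) (fun X => G X) (fun X Y f => @fmap _ _ G Y X f)
    (fun X => fmap1 G X) (fun X Y Z g f => @fmapM _ _ G Z Y X f g).

Definition adjunction_to_op (G : functor C (full S)) (a : adjunction G (inclusion S)) :
    adjunction (inclusion (opsub S)) (functor_to_op G) :=
  @Adjunction (full (opsub S)) opadd (inclusion (opsub S)) (functor_to_op G)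
    (fun X => adj_counit a X) (fun Y => adj_unit a Y)
    (fun X X' f => esym (@counit_nat _ _ _ _ a X' X f))
    (fun Y Y' f => esym (@unit_nat _ _ _ _ a Y' Y f))
    (fun X => adj_triangleR a X) (fun Y => adj_triangleL a Y).

Definition adjunction_of_op (G : functor opadd (full (opsub S)))
    (a : adjunction (inclusion (opsub S)) G) :
    adjunction (functor_of_op G) (inclusion S) :=
  @Adjunction C (full S) (functor_of_op G) (inclusion S)
    (fun X => adj_counit a X) (fun Y => adj_unit a Y)
    (fun X X' f => esym (@counit_nat _ _ _ _ a X' X f))
    (fun Y Y' f => esym (@unit_nat _ _ _ _ a Y' Y f))
    (fun X => adj_triangleR a X) (fun Y => adj_triangleL a Y).

Lemma reflective_op : reflective S <-> coreflective (opsub S).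
Proof.
split=> -[G [a]].
  by exists (functor_to_op G); split; apply: adjunction_to_op.
by exists (functor_of_op G); split; apply: adjunction_of_op.
Qed.

Lemma left_rejective_op : left_rejective S <-> right_rejective (opsub S).
Proof.
split=> -[G [a am]].
  by exists (functor_to_op G), (adjunction_to_op a) => X W f g; apply: am.
by exists (functor_of_op G), (adjunction_of_op a) => X W f g; apply: am.
Qed.

Variables M N : C.
Hypotheses (spl : split_idempotents C) (SM : forall X, S X <-> power_retract M X).
Hypothesis NC : forall X, power_retract N X.

Let opSM (X : opadd) : opsub S X <-> @power_retract opadd M X.
Proof. by rewrite -op_power_retract; apply: SM. Qed.

Let opNC (X : opadd) : @power_retract opadd N X.
Proof. by rewrite -op_power_retract; apply: NC. Qed.

Lemma reflectiveP : reflective S <-> @mor_dual_basis opadd M N M.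
Proof.
exact: iff_trans reflective_op (coreflectiveP (op_split_idempotents spl) opSM opNC).
Qed.

Lemma left_rejectiveP : left_rejective S <-> @mor_dual_basis opadd M N N.
Proof.
exact: iff_trans left_rejective_op (right_rejectiveP (op_split_idempotents spl) opSM opNC).
Qed.

End Opposite.

(** * Chain steps inside a full subcategory *)

Section Full.
Variables (C : addcat) (S : subcat C).

Variables (T : subcat C) (M N : C) (SM : S M) (SN : S N).
Hypotheses (spl : split_idempotents C).
Hypothesis TM : forall X, T X <-> power_retract M X.
Hypothesis SNE : forall X, S X <-> power_retract N X.

Let TM' (X : full S) : sub_in S T X <-> @power_retract (full S) (exist _ M SM) X.
Proof. exact: (TM (sval X)). Qed.

Let NC' (X : full S) : @power_retract (full S) (exist _ N SN) X.
Proof. exact: (proj1 (SNE (sval X)) (svalP X)). Qed.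

Lemma coreflective_subP : coreflective (sub_in S T) <-> mor_dual_basis M N M.
Proof. exact: (coreflectiveP (split_idempotents_full spl) TM' NC'). Qed.

Lemma reflective_subP : reflective (sub_in S T) <-> @mor_dual_basis (opadd C) M N M.
Proof. exact: (reflectiveP (split_idempotents_full spl) TM' NC'). Qed.

Lemma cosemisimple_subP : cosemisimple (sub_in S T) <->
  forall b : mor N N,
    (forall y : mor N N, exists z, factors_sum M (z \oc (idm N - y \oc b) - idm N) /\
       factors_sum M ((idm N - y \oc b) \oc z - idm N)) ->
    factors_sum M b.
Proof. exact: (cosemisimpleP TM' NC'). Qed.

End Full.

(** * Homomorphisms between the modules eA *)

Definition mk_linear (B : pzRingType) (U V : lmodType B) (f : U -> V) (fl : linear f) :
    {linear U -> V} :=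
  HB.pack_for {linear U -> V} f (GRing.isLinear.Build B U V *:%R f fl).

Lemma modcat_split_idempotents (B : pzRingType) : split_idempotents (modcat B).
Proof.
move=> X p pp; pose P : {linear X -> X} := p.
have PP x : P (P x) = P x.
  exact: (congr1 (fun f : linhom X X => (f : {linear _ -> _}) x) pp).
pose S : {pred X} := fun x => `[< P x = x >].
have Scl : submod_closed S.
  split=> [|a x y /asboolP Sx /asboolP Sy]; apply/asboolP; first exact: linear0.
  by rewrite linearP Sx Sy.
pose S' : submodClosed X := HB.pack_for (submodClosed X) S
  (GRing.isSubmodClosed.Build B X S Scl).
pose Y : lmodType B := submod S'.
have valL : linear (val : Y -> X) by [].
have SP x : P x \in S' by apply/asboolP.
pose q x : Y := Sub (P x) (SP x).
have qL : linear q by move=> a x y; apply: val_inj; rewrite /= linearP.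
exists Y, (mk_linear valL), (mk_linear qL); split; apply: linhom_eq => x //=.
apply: val_inj; rewrite /=; exact/asboolP/(valP x).
Qed.

Lemma linhom_sumE (B : pzRingType) (U V : lmodType B) (I : finType)
    (F : I -> linhom U V) (x : U) :
  ((\sum_k F k : linhom U V) : {linear U -> V}) x = \sum_k (F k : {linear U -> V}) x.
Proof. exact: (big_morph (fun f : linhom U V => (f : {linear U -> V}) x)). Qed.

Section HomCorners.
Variable A : pzRingType.
Implicit Types (e f g h : A).

Lemma eA_gen_in e : e \in eA_pred e.
Proof. by apply/asboolP; exists 1; rewrite mulr1. Qed.

Definition eA_gen e : eA e := exist _ e (eA_gen_in e).

(** Evaluation at the generator g identifies Hom(gA, fA) with fAg. *)
Definition mor_elt f g (phi : linhom (eA g) (eA f)) : A :=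
  val ((phi : {linear eA g -> eA f}) (eA_gen g)).

Lemma val_eA e (y : eA e) : e * e = e -> e * val y = val y :> A.
Proof. by move=> ee; case/asboolP: (valP y) => a ->; rewrite mulrA ee. Qed.

Lemma eA_genE e (y : eA e) : e * e = e -> y = (val y : A^c) *: eA_gen e.
Proof. by move=> ee; apply: val_inj; rewrite -[LHS](val_eA y ee). Qed.

Lemma mor_elt_app f g (phi : linhom (eA g) (eA f)) y : g * g = g ->
  val ((phi : {linear eA g -> eA f}) y) = mor_elt phi * val y :> A.
Proof. by move=> gg; rewrite {1}(eA_genE y gg) linearZ. Qed.

Lemma mor_elt_corner f g (phi : linhom (eA g) (eA f)) :
  f * f = f -> g * g = g -> corner f g (mor_elt phi).
Proof.
move=> ff gg; rewrite /corner /mor_elt val_eA // -[RHS](mor_elt_app phi (eA_gen g) gg) //.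
Qed.

Lemma mor_elt_inj f g (phi psi : linhom (eA g) (eA f)) : g * g = g ->
  mor_elt phi = mor_elt psi -> phi = psi.
Proof.
move=> gg E; apply: linhom_eq => y; apply: val_inj.
by rewrite !mor_elt_app // E.
Qed.

Lemma mor_elt_surj f g x : f * f = f -> g * g = g -> corner f g x ->
  exists phi : linhom (eA g) (eA f), mor_elt phi = x.
Proof.
move=> ff gg xP.
have xS (y : eA g) : x * (val y : A) \in eA_pred f.
  by apply/asboolP; exists (x * val y); rewrite mulrA (corner_l ff xP).
pose phi (y : eA g) : eA f := exist _ (x * (val y : A)) (xS y).
have phiL : linear phi.
  move=> a y z; apply: val_inj; rewrite submod_valP /=.
  by rewrite [LHS](_ : _ = x * ((val y : A) * a + val z)) // mulrDr mulrA.
by exists (mk_linear phiL); apply: (corner_r gg xP).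
Qed.

Lemma mor_elt_comp f g h (phi : linhom (eA g) (eA f)) (psi : linhom (eA h) (eA g)) :
  g * g = g -> mor_elt (linhom_comp phi psi) = mor_elt phi * mor_elt psi.
Proof. by move=> gg; rewrite -mor_elt_app. Qed.

Lemma mor_elt_id g : mor_elt (linhom_id (eA g)) = g.
Proof. by []. Qed.

End HomCorners.

(* Hom(X, Y) is identified with the corner gAf; over the converse ring this
   also covers the opposite category. *)
Definition corner_rep (A : pzRingType) (C : precat) (X Y : C) (f g : A)
    (t : mor X Y -> A) : Prop :=
  [/\ {morph t : x y / x + y}, injective t, forall x, corner g f (t x)
    & forall x, corner g f x -> exists y, t y = x].

Section CornerRep.
Variables (A : pzRingType) (C : precat).

Lemma corner_rep0 (X Y : C) (f g : A) (t : mor X Y -> A) :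
  corner_rep f g t -> t 0 = 0.
Proof. by move=> [tD _ _ _]; apply: (addrI (t 0)); rewrite -tD !addr0. Qed.

Lemma corner_rep_sum (X Y : C) (f g : A) (t : mor X Y -> A) (J : finType)
  (x : J -> mor X Y) : corner_rep f g t -> t (\sum_j x j) = \sum_j t (x j).
Proof.
by move=> rt; have [tD _ _ _] := rt; apply: (big_morph t tD (corner_rep0 rt)).
Qed.

Lemma mor_dual_basisP (M N W : C) (f g w : A)
    (tMN : mor M N -> A) (tMM : mor M M -> A) (tWM : mor W M -> A) (tWN : mor W N -> A) :
  corner_rep g f tMN -> corner_rep g g tMM -> corner_rep w g tWM ->
  corner_rep w f tWN ->
  (forall x y, tMN (x \oc y) = tMN x * tMM y) ->
  (forall x y, tWM (x \oc y) = tMM x * tWM y) ->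
  (forall x y, tWN (x \oc y) = tMN x * tWM y) ->
  mor_dual_basis M N W <-> dual_basis f g w.
Proof.
move=> rMN rMM rWM rWN cMN cWM cWN.
have [_ iMN pMN sMN] := rMN; have [_ iMM pMM sMM] := rMM.
have [_ iWM pWM sWM] := rWM; have [_ iWN pWN sWN] := rWN.
have inv (X Y : C) (p q : A) (t : mor X Y -> A) : corner_rep p q t ->
    exists s : A -> mor X Y, forall x, corner q p x -> t (s x) = x.
  move=> [_ _ _ tS].
  have /choice [s sP] x : exists y, corner q p x -> t y = x.
    case: (pselect (corner q p x)) => [/tS [y yE]|n]; first by exists y.
    by exists 0.
  by exists s.
have [v vK] := inv _ _ _ _ _ rMN; have [v' vK'] := inv _ _ _ _ _ rMM.
have [v'' vK''] := inv _ _ _ _ _ rWM.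
split=> -[I [u [c]]].
  move=> [uc lc]; exists I, (fun k => tMN (u k)), (fun k x => tMM (c k (v x))).
  split=> // [x xP|k J x b xP bP xb0].
    rewrite -{1}(vK x xP) {1}[v x]uc (corner_rep_sum _ rMN).
    by apply: eq_bigr => k _; rewrite cMN.
  have := lc k J (fun j => v (x j)) (fun j => v'' (b j)).
  have -> : \sum_j v (x j) \oc v'' (b j) = 0.
    apply: iWN; rewrite (corner_rep_sum _ rWN) (corner_rep0 rWN) -[RHS]xb0.
    by apply: eq_bigr => j _; rewrite cWN vK // vK''.
  move=> /(_ erefl) /(congr1 tWM); rewrite (corner_rep_sum _ rWM) (corner_rep0 rWM).
  by apply: etrans; apply: eq_bigr => j _; rewrite cWM vK''.
move=> [uP cP uc lc]; exists I, (fun k => v (u k)), (fun k x => v' (c k (tMN x))).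
split=> [x|k J x b xb0].
  apply: iMN; rewrite (corner_rep_sum _ rMN) {1}(uc _ (pMN x)).
  by apply: eq_bigr => k _; rewrite cMN vK // vK' //; apply: cP.
apply: iWM; rewrite (corner_rep_sum _ rWM) (corner_rep0 rWM).
rewrite (eq_bigr (fun j => c k (tMN (x j)) * tWM (b j))); last first.
  by move=> j _; rewrite cWM vK' //; apply: cP.
apply: lc => //; move/(congr1 tWN): xb0; rewrite (corner_rep_sum _ rWN) (corner_rep0 rWN).
by apply: etrans; apply: eq_bigr => j _; rewrite cWN.
Qed.

End CornerRep.

Section ProjCat.
Variable A : pzRingType.

Definition eP (e : A) (ee : e * e = e) : projcat A :=
  exist _ (eA e : modcat A^c) (eA_proj ee).

Lemma mor_elt_rep (f g : A) (ff : f * f = f) (gg : g * g = g) :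
  @corner_rep A (projcat A) (eP gg) (eP ff) g f (@mor_elt A f g).
Proof.
split=> //.
- by move=> x y; apply: mor_elt_inj.
- by move=> x; apply: mor_elt_corner.
- by move=> x; apply: mor_elt_surj.
Qed.

Lemma mor_elt_rep_op (f g : A) (ff : f * f = f) (gg : g * g = g) :
  @corner_rep A^c (opadd (projcat A)) (eP gg) (eP ff) g f (@mor_elt A g f).
Proof.
have cE (x : A) : @corner A^c f g x <-> corner g f x by rewrite /corner mulcE mulrA.
split=> //.
- by move=> x y; apply: (@mor_elt_inj A g f x y ff).
- by move=> x; apply/cE; apply: (@mor_elt_corner A g f x gg ff).
- by move=> x /cE; apply: mor_elt_surj.
Qed.

Lemma proj_dual_basisP (f g w : A) (ff : f * f = f) (gg : g * g = g) (ww : w * w = w) :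
  mor_dual_basis (eP gg) (eP ff) (eP ww) <-> dual_basis f g w.
Proof.
by apply: (mor_dual_basisP (mor_elt_rep ff gg) (mor_elt_rep gg gg)
  (mor_elt_rep gg ww) (mor_elt_rep ff ww)) => x y; apply: mor_elt_comp.
Qed.

Lemma proj_op_dual_basisP (f g w : A) (ff : f * f = f) (gg : g * g = g) (ww : w * w = w) :
  @mor_dual_basis (opadd (projcat A)) (eP gg) (eP ff) (eP ww) <->
  @dual_basis A^c f g w.
Proof.
have compE (h k : A) (x : linhom (eA k) (eA g)) (y : linhom (eA g) (eA h)) :
    mor_elt (linhom_comp y x) = (mor_elt x : A^c) * (mor_elt y : A^c) := mor_elt_comp y x gg.
by apply: (mor_dual_basisP (mor_elt_rep_op ff gg) (mor_elt_rep_op gg gg)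
  (mor_elt_rep_op gg ww) (mor_elt_rep_op ff ww)) => x y; apply: compE.
Qed.

(** The dual basis lemma: the coordinates of X and its generators compose to the identity through
    copies of A = 1A. *)
Lemma proj_retract (X : projcat A) : power_retract (eP (mulr1 1)) X.
Proof.
have [[m [s gen]] pX] := svalP X.
have [d [dl dE]] := projective_coord gen pX.
have d1 k x : (d k x : A) \in eA_pred (1 : A) by apply/asboolP; exists (d k x); rewrite mul1r.
pose b k x : eA (1 : A) := exist _ (d k x) (d1 k x).
have bL k : linear (b k).
  by move=> r x y; apply: val_inj; rewrite submod_valP; apply: dl.
pose a k (y : eA (1 : A)) := (val y : A^c) *: s k.
have aL k : linear (a k).
  by move=> r x y; rewrite /a submod_valP scalerDl -scalerA.
exists 'I_m, (fun k => mk_linear (aL k)), (fun k => mk_linear (bL k)).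
by apply: linhom_eq => x; rewrite [LHS]linhom_sumE [RHS](dE x).
Qed.

Lemma add_eAP (g : A) (gg : g * g = g) (X : projcat A) :
  add_eA g X <-> power_retract (eP gg) X.
Proof. exact: (in_addP _ _ (@modcat_split_idempotents A^c)). Qed.

Lemma projcat_split : split_idempotents (projcat A).
Proof. exact/split_idempotents_full/modcat_split_idempotents. Qed.

Lemma retract_eP (f g : A) (ff : f * f = f) (gg : g * g = g) : in_AeA f g ->
  power_retract (eP ff) (eP gg).
Proof.
move=> [J [a [b gE]]].
have /choice [al alE] j := mor_elt_surj gg ff (corner_mk (a j) gg ff).
have /choice [be beE] j := mor_elt_surj ff gg (corner_mk (b j) ff gg).
exists J, al, be; apply: (mor_elt_inj gg); rewrite mor_elt_id.
have gE' : g = \sum_j g * (a j * f * b j) * g.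
  by rewrite -mulr_suml -mulr_sumr -gE !gg.
rewrite (corner_rep_sum _ (mor_elt_rep gg gg)) [RHS]gE'; apply: eq_bigr => j _.
by rewrite [LHS]mor_elt_comp // alE beE -!mulrA (mulrA f f) ff.
Qed.

Lemma right_rejective_add_eA (g : A) : g * g = g ->
  right_rejective (add_eA g) <-> dual_basis 1 g 1.
Proof.
move=> gg; apply: iff_trans (proj_dual_basisP (mulr1 1) gg (mulr1 1)).
exact: (right_rejectiveP projcat_split (add_eAP gg) proj_retract).
Qed.

Lemma left_rejective_add_eA (g : A) : g * g = g ->
  left_rejective (add_eA g) <-> @dual_basis A^c 1 g 1.
Proof.
move=> gg; apply: iff_trans (proj_op_dual_basisP (mulr1 1) gg (mulr1 1)).
exact: (left_rejectiveP projcat_split (add_eAP gg) proj_retract).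
Qed.

Section Step.
Variables (f g : A) (ff : f * f = f) (gg : g * g = g) (fg : in_AeA f g).

Lemma add_eA_self : add_eA f (eP ff).
Proof. exact/(add_eAP ff)/power_retract_refl. Qed.

Lemma add_eA_idem : add_eA f (eP gg).
Proof. exact/(add_eAP ff)/retract_eP. Qed.

Lemma coreflective_add_eA :
  coreflective (sub_in (add_eA f) (add_eA g)) <-> dual_basis f g g.
Proof.
apply: iff_trans (proj_dual_basisP ff gg gg).
exact: (coreflective_subP add_eA_idem add_eA_self projcat_split (add_eAP gg) (add_eAP ff)).
Qed.

Lemma reflective_add_eA :
  reflective (sub_in (add_eA f) (add_eA g)) <-> @dual_basis A^c f g g.
Proof.
apply: iff_trans (proj_op_dual_basisP ff gg gg).
exact: (reflective_subP add_eA_idem add_eA_self projcat_split (add_eAP gg) (add_eAP ff)).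
Qed.

Lemma factors_sumP (b : mor (eP ff) (eP ff)) :
  factors_sum (eP gg) b <-> in_AeA g (mor_elt b).
Proof.
split=> [[I [a [c ->]]]|[J [a [c bE]]]].
  rewrite (corner_rep_sum _ (mor_elt_rep ff ff)); apply: in_AeA_sum => k.
  rewrite [X in in_AeA g X]mor_elt_comp // -(corner_r gg (mor_elt_corner (a k) ff gg)).
  exact: in_AeA1.
have /choice [al alE] j := mor_elt_surj ff gg (corner_mk (a j) ff gg).
have /choice [be beE] j := mor_elt_surj gg ff (corner_mk (c j) gg ff).
exists J, al, be; apply: (mor_elt_inj ff).
rewrite (corner_rep_sum _ (mor_elt_rep ff ff)) (mor_elt_corner b ff ff) bE.
rewrite mulr_sumr mulr_suml; apply: eq_bigr => j _.
by rewrite [RHS]mor_elt_comp // alE beE -!mulrA (mulrA g g) gg.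
Qed.

(** The endomorphisms of fA that factor through add gA form fAf intersected with AgA, so in the
    factor category the endomorphism ring of fA is the corner of B at p(f). *)
Lemma cosemisimple_add_eA (B : pzRingType) (p : A -> B) : quotient_map p g ->
  cosemisimple (sub_in (add_eA f) (add_eA g)) <-> semiprimitive_corner (p f).
Proof.
move=> qp; have [pD pM p1 /choice [s sK] ker] := qp.
have pff : p f * p f = p f by rewrite -pM ff.
apply: iff_trans (cosemisimple_subP add_eA_idem add_eA_self (add_eAP gg) (add_eAP ff)) _.
have E (y b : mor (eP ff) (eP ff)) :
    mor_elt (idm (eP ff) - y \oc b) = f - mor_elt y * mor_elt b.
  by rewrite -(mor_elt_comp y b ff).
have FS (z x : mor (eP ff) (eP ff)) :
    factors_sum (eP gg) (z \oc x - idm (eP ff)) <-> p (mor_elt z) * p (mor_elt x) = p f.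
  rewrite factors_sumP -pM -mor_elt_comp // (quotient_mapP qp).
  split; exact id.
have lift y : corner (p f) (p f) y -> exists x : mor (eP ff) (eP ff), p (mor_elt x) = y.
  move=> yP; have [x xE] := mor_elt_surj ff ff (corner_mk (s y) ff ff).
  by exists x; rewrite xE !pM sK -yP.
have corn (x : mor (eP ff) (eP ff)) : corner (p f) (p f) (p (mor_elt x)).
  by rewrite /corner -!pM -(mor_elt_corner x ff ff).
have pE (y b : mor (eP ff) (eP ff)) :
    p (mor_elt (idm (eP ff) - y \oc b)) = p f - p (mor_elt y) * p (mor_elt b).
  by rewrite E (quotient_mapB qp) pM.
split=> [cs b' bP inv|sp b inv].
  have [b bE] := lift b' bP; rewrite -bE; apply/ker/factors_sumP.
  apply: cs => y; have [z' [zP zl zr]] := inv _ (corn y); have [z zE] := lift z' zP.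
  by exists z; split; apply/FS; rewrite pE bE zE.
apply/factors_sumP/ker/sp => // y' yP; have [y yE] := lift y' yP.
have [z [/FS zl /FS zr]] := inv y.
by exists (p (mor_elt z)); rewrite -yE -pE.
Qed.

End Step.

End ProjCat.

(** * Chains of idempotent ideals *)

(** Supplies the idempotence of H_i / H_(i+1) demanded by [heredity_ideal]: each aeb is the product
    of ae and eb. *)
Lemma idempotent_AeA (A : pzRingType) (H : ideal A) (e : A) : e * e = e ->
  (forall x, ideal_set H x <-> in_AeA e x) -> idempotent_ideal H.
Proof.
move=> ee HE; apply/seteqP; split=> x.
  move=> [m [p [q [pqP ->]]]]; elim/big_ind: _ => [|y z|i _].
  - exact: ideal0.
  - exact: idealD.
  - by have [Hp _] := pqP i; apply: idealMr.
move=> /HE /AeAP [m [p [q [pP ->]]]]; exists m, p, (fun i => e * q i).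
split=> [i|].
  have [[k [r [t [rtP ->]]]] _] := pP i; split; last exact/HE/in_AeAMr/in_AeA_id.
  by apply/HE/in_AeA_sum => j; have [_ ->] := rtP j; apply/in_AeAMl/in_AeA_id.
apply: eq_bigr => i _; have [[k [r [t [rtP ->]]]] _] := pP i.
rewrite !mulr_suml; apply: eq_bigr => j _; have [_ ->] := rtP j.
by rewrite -!mulrA (mulrA e e) ee.
Qed.

(** Projectivity is demanded of H_0, ..., H_(n-1), rejectivity of the subcategories 1, ..., n. With
    [forall_hi] both ranges are completed to 0, ..., n, the missing ends e_n = 0 and Ae_0A = A being
    trivial. *)
Lemma forall_lo n (P : 'I_n.+1 -> Prop) : P ord_max ->
  (forall k, P k) <-> (forall i : 'I_n, P (lo i)).
Proof.
move=> Pn; split=> // Plo k; case: (ltnP k n) => [kn|nk].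
  by rewrite (_ : k = lo (Ordinal kn)) //; apply: val_inj.
rewrite (_ : k = ord_max) //; apply/val_inj/eqP.
by rewrite /= eqn_leq nk -ltnS ltn_ord.
Qed.

Lemma forall_hi n (P : 'I_n.+1 -> Prop) : P ord0 ->
  (forall k, P k) <-> (forall i : 'I_n, P (hi i)).
Proof.
by move=> P0; split=> // Phi k; case: (unliftP ord0 k) => [i ->|-> //]; apply: Phi.
Qed.

Section Chain.
Variables (A : pzRingType) (hA : artin_algebra A) (n : nat).
Variables (H : 'I_n.+1 -> ideal A) (e : 'I_n.+1 -> A).
Hypotheses (hH : idempotent_ideal_chain H) (ee : forall i, e i * e i = e i).
Hypothesis hHe : forall i : 'I_n, ideal_set (H (lo i)) = AeA (e (lo i)).
Hypothesis hen : e ord_max = 0.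

Lemma chain_idealE i x : ideal_set (H i) x <-> in_AeA (e i) x.
Proof.
move: i x; apply/forall_lo => [x|i x]; last by rewrite hHe AeAP.
have [_ _ -> _] := hH; rewrite hen; split=> [->|[J [a [b ->]]]].
  exact: in_AeA0.
by apply: big1 => j _; rewrite mulr0 mul0r.
Qed.

Lemma chain_top : in_AeA (e ord0) 1.
Proof. by apply/chain_idealE; have [-> _ _ _] := hH. Qed.

Lemma chain_step (i : 'I_n) : in_AeA (e (lo i)) (e (hi i)).
Proof.
apply/chain_idealE; have [_ /(_ i) [sub _] _ _] := hH.
exact/sub/chain_idealE/in_AeA_id.
Qed.

Let B (i : 'I_n) : pzRingType := quot_ring (H (hi i)).
Let p (i : 'I_n) : A -> B i := quot_pi (H (hi i)).

Lemma chain_quotient i : quotient_map (p i) (e (hi i)).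
Proof. exact: (quot_pi_quotient_map (chain_idealE (hi i))). Qed.

Lemma chain_quotient_idem i : p i (e (lo i)) * p i (e (lo i)) = p i (e (lo i)).
Proof. by have [_ pM _ _ _] := chain_quotient i; rewrite -pM ee. Qed.

Lemma chain_quot_idealE i x :
  ideal_set (quot_ideal (H (hi i)) (H (lo i))) x <-> in_AeA (p i (e (lo i))) x.
Proof. exact: (quot_idealE (chain_idealE (hi i)) (chain_idealE (lo i))). Qed.

Lemma chain_quot_artin i : artin_algebra (B i).
Proof. exact: (quot_artin (chain_idealE (hi i)) hA). Qed.

Lemma chain_radical i : radical_vanishing (quot_ideal (H (hi i)) (H (lo i))) <->
  semiprimitive_corner (p i (e (lo i))).
Proof. exact: (radical_vanishingP (chain_quotient_idem i) (@chain_quot_idealE i)). Qed.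

Lemma chain_cosemisimple i : cosemisimple_step (fun i => add_eA (e i)) i <->
  semiprimitive_corner (p i (e (lo i))).
Proof.
exact: (cosemisimple_add_eA (ee _) (ee _) (chain_step i) (chain_quotient i)).
Qed.

Lemma chain_heredity_ideal i : heredity_ideal (quot_ideal (H (hi i)) (H (lo i))) <->
  dual_basis 1 (p i (e (lo i))) 1 /\ semiprimitive_corner (p i (e (lo i))).
Proof.
rewrite -chain_radical -(right_module_projectiveP (chain_quot_artin i)
  (chain_quotient_idem i) (@chain_quot_idealE i)).
split=> [[]|[] //]; split=> //.
exact: (idempotent_AeA (chain_quotient_idem i) (@chain_quot_idealE i)).
Qed.

Lemma add_eA_chain : subcat_chain (fun i => add_eA (e i)).
Proof.
split.
- move=> X; apply/(add_eAP (ee ord0)).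
  exact: power_retract_trans (retract_eP _ _ chain_top) (proj_retract X).
- move=> i X /(add_eAP (ee _)) X1; apply/(add_eAP (ee _)).
  exact: power_retract_trans (retract_eP _ _ (chain_step i)) X1.
move=> X /(add_eAP (ee _)) [I [a [b ab]]]; apply: zero_obj_id; rewrite -ab.
apply: big1 => t _; rewrite [a t](_ : _ = 0) ?comp0m //.
apply: linhom_eq => y; rewrite [y](_ : _ = 0) ?linear0 //; apply: val_inj.
case/asboolP: (valP y) => c ->.
have c0 : e ord_max * c = 0 by rewrite hen mul0r.
exact: c0.
Qed.

Let strong k := dual_basis 1 (e k) 1.
Let strong' k := @dual_basis A^c 1 (e k) 1.
Let sp i := semiprimitive_corner (p i (e (lo i))).

Lemma strong_lo : (forall k, strong k) <-> forall i : 'I_n, strong (lo i).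
Proof. by apply: forall_lo; rewrite /strong hen; apply: dual_basis0. Qed.

Lemma strong_hi : (forall k, strong k) <-> forall i : 'I_n, strong (hi i).
Proof. by apply: forall_hi; apply: dual_basis_full => //; apply: chain_top. Qed.

Lemma strong'_lo : (forall k, strong' k) <-> forall i : 'I_n, strong' (lo i).
Proof. by apply: forall_lo; rewrite /strong' hen; apply: dual_basis0. Qed.

Lemma strong'_hi : (forall k, strong' k) <-> forall i : 'I_n, strong' (hi i).
Proof.
apply: forall_hi; apply: dual_basis_full; first exact: ee.
exact/in_AeA_converse/chain_top.
Qed.

Lemma right_strongly_heredity_chainP : right_strongly_heredity_chain H <->
  (forall k, strong k) /\ forall i, sp i.
Proof.
have PE i : projective (right_module (H (lo i))) <-> strong (lo i).
  exact: (right_module_projectiveP hA (ee _) (chain_idealE _)).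
rewrite strong_lo; split=> [[_ R]|[S T]].
  by split=> i; have [/PE ? /chain_radical] := R i.
split=> // i; split; [exact/PE/S | exact/chain_radical/T].
Qed.

Lemma left_strongly_heredity_chainP : left_strongly_heredity_chain H <->
  (forall k, strong' k) /\ forall i, sp i.
Proof.
have PE i : projective (left_module (H (lo i))) <-> strong' (lo i).
  exact: (left_module_projectiveP hA (ee _) (chain_idealE _)).
rewrite strong'_lo; split=> [[_ R]|[S T]].
  by split=> i; have [/PE ? /chain_radical] := R i.
split=> // i; split; [exact/PE/S | exact/chain_radical/T].
Qed.

Lemma total_right_rejective_chainP : total_right_rejective_chain (fun i => add_eA (e i)) <->
  (forall k, strong k) /\ forall i, sp i.
Proof.
rewrite strong_hi; split=> [[_ R]|[S T]].
  by split=> i; have [/(right_rejective_add_eA (ee _)) ? /chain_cosemisimple] := R i.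
split; first exact: add_eA_chain.
move=> i; split; last exact/chain_cosemisimple/T.
exact/(right_rejective_add_eA (ee _))/S.
Qed.

Lemma total_left_rejective_chainP : total_left_rejective_chain (fun i => add_eA (e i)) <->
  (forall k, strong' k) /\ forall i, sp i.
Proof.
rewrite strong'_hi; split=> [[_ R]|[S T]].
  by split=> i; have [/(left_rejective_add_eA (ee _)) ? /chain_cosemisimple] := R i.
split; first exact: add_eA_chain.
move=> i; split; last exact/chain_cosemisimple/T.
exact/(left_rejective_add_eA (ee _))/S.
Qed.

Lemma coreflective_heredity_chainP :
  heredity_chain H /\ coreflective_chain (fun i => add_eA (e i)) <->
  (forall k, strong k) /\ forall i, sp i.
Proof.
have CE i := coreflective_add_eA (ee (lo i)) (ee (hi i)) (chain_step i).
rewrite (dual_basis_chain ee chain_top hen chain_step chain_quotient).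
split=> [[[_ R] [_ T]]|[R T]].
  split=> i; have [/chain_heredity_ideal [db rad] [_ /CE]] := conj (R i) (T i) => //.
split.
  by split=> // i; apply/chain_heredity_ideal; have [] := R i; split=> //; apply: T.
split=> [|i]; first exact: add_eA_chain.
by split; [apply/chain_cosemisimple/T | apply/CE; have [] := R i].
Qed.

Lemma reflective_heredity_chainP :
  heredity_chain H /\ reflective_chain (fun i => add_eA (e i)) <->
  (forall k, strong' k) /\ forall i, sp i.
Proof.
have CE i := reflective_add_eA (ee (lo i)) (ee (hi i)) (chain_step i).
have qc i := quotient_map_converse (chain_quotient i).
have top' : @in_AeA A^c (e ord0) 1 by apply/in_AeA_converse/chain_top.
have step' i : @in_AeA A^c (e (lo i)) (e (hi i)) by apply/in_AeA_converse/chain_step.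
(* [heredity_chain] speaks of right modules here too; at each step the vanishing radical allows the
   change of side. *)
have sym i : sp i -> _ := heredity_symmetric (chain_quot_artin i) (chain_quotient_idem i).
rewrite (@dual_basis_chain A^c n e (fun i => (B i)^c) p ee top' hen step' qc).
split=> [[[_ R] [_ T]]|[R T]].
  by split=> i; have [/chain_heredity_ideal [db rad] [_ /CE]] := conj (R i) (T i) => //;
    split=> //; apply/sym.
split.
  split=> // i; apply/chain_heredity_ideal; split; last exact: T.
  by apply/(sym i (T i)); have [] := R i.
split=> [|i]; first exact: add_eA_chain.
by split; [apply/chain_cosemisimple/T | apply/CE; have [] := R i].
Qed.

End Chain.

Theorem theorem1p2 (A : pzRingType) (hA : artin_algebra A) (n : nat)
    (H : 'I_n.+1 -> ideal A) (e : 'I_n.+1 -> A)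
    (hH : idempotent_ideal_chain H)
    (he : forall i, e i * e i = e i)
    (hHe : forall i : 'I_n, ideal_set (H (lo i)) = AeA (e (lo i)))
    (hen : e ord_max = 0) :
  ((right_strongly_heredity_chain H <->
      total_right_rejective_chain (fun i => add_eA (e i))) /\
   (total_right_rejective_chain (fun i => add_eA (e i)) <->
      heredity_chain H /\ coreflective_chain (fun i => add_eA (e i)))) /\
  ((left_strongly_heredity_chain H <->
      total_left_rejective_chain (fun i => add_eA (e i))) /\
   (total_left_rejective_chain (fun i => add_eA (e i)) <->
      heredity_chain H /\ reflective_chain (fun i => add_eA (e i)))).
Proof.
(* On each side the three conditions reduce to one statement: every e_k has a dual basis with w = 1,
   and every corner has zero radical. *)
rewrite (right_strongly_heredity_chainP hA hH he hHe hen).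
rewrite (total_right_rejective_chainP hH he hHe hen).
rewrite (coreflective_heredity_chainP hA hH he hHe hen).
rewrite (left_strongly_heredity_chainP hA hH he hHe hen).
rewrite (total_left_rejective_chainP hH he hHe hen).
by rewrite (reflective_heredity_chainP hA hH he hHe hen).
Qed.
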